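(* Let $F$ be a free group, let $X$ be a subgroup of $F$ and let $Y$ be a normal subgroup of $X$ such that $X/Y$ is a free abelian group (not necessarily finitely generated). Then there exists a free basis of $X$ which is a disjoint union $A\cup B$, totally ordered so that every member of $A$ precedes every member of $B$, such that $B\cup U$ is a free basis of $Y$, where $U=U(A,B)$ is the set obtained from $A\cup B$ by the $U$-construction.
   Context: Commutators: $[x,y]=x^{-1}y^{-1}xy$, and longer commutators are left-normed, $[x_1,\dots,x_{k+1}]=[[x_1,\dots,x_k],x_{k+1}]$. $U$-construction: let $A,B$ be disjoint subsets of a group with $A\cup B$ totally ordered so that every member of $A$ precedes every member of $B$. Then $U(A,B)$ is the set of all elements $$[b^{\beta},a_1^{\alpha_1},a_2^{\alpha_2},\dots,a_q^{\alpha_q}]$$ with $q\ge 1$, $b\in A\cup B$, $a_i\in A$, $\beta,\alpha_i\in\{+1,-1\}$, $b>a_1\le a_2\le\dots\le a_q$, $\beta=+1$ whenever $b\in B$, and the indices being index coherent: whenever two of the elements $b,a_1,\dots,a_q$ are equal, their exponents are equal. *)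

(* Defs.v *)
From mathcomp Require Import all_boot ssralg ssrint.
From mathcomp Require Import monoid boolp classical_sets functions.
From mathcomp.multinomials Require Import freeg.

Set Implicit Arguments.
Unset Strict Implicit.
Unset Printing Implicit Defensive.

Local Open Scope classical_set_scope.
Local Open Scope group_scope.

Section Subgroups.
Variable G : groupType.
Implicit Types (X Y C D : set G).

Definition subgroup X : Prop := group_closed [in X].

Definition normal_subgroup Y X : Prop :=
  [/\ subgroup Y, Y `<=` X & forall x y, X x -> Y y -> Y (y ^ x)].

Definition set_prod C D : set G := [set c * d | c in C & d in D].

Definition left_coset (x : G) Y : set G := [set x * y | y in Y].

(* The carrier of X / Y; its group law is set_prod. *)
Definition cosets X Y : set (set G) := [set left_coset x Y | x in X].

(* {freeg I} is the free abelian group on I (finitely supported functions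
   from I to int, written additively); I may be infinite. *)
Definition free_abelian_quotient X Y : Prop :=
  exists (I : choiceType) (phi : set G -> {freeg I}),
    set_bij (cosets X Y) [set: {freeg I}] phi /\
    {in cosets X Y &, forall C D, phi (set_prod C D) = (phi C + phi D)%R}.

End Subgroups.

Section FreeGroups.
Variable G : groupType.
Implicit Types (S X : set G) (l : G * bool) (w : seq (G * bool)).

(* The pair (x, e) stands for x^{+1} if e is true and for x^{-1} if e is
   false. *)
Definition letter_val l : G := if l.2 then l.1 else l.1^-1.

Definition word_val w : G := \prod_(l <- w) letter_val l.

Definition reduced_word w : bool :=
  sorted (fun l l' => l' != (l.1, ~~ l.2)) w.

Definition reduced_words_over S : set (seq (G * bool)) :=
  [set w | {in w, forall l, S l.1} /\ reduced_word w].

(* Every element of X is the value of exactly one reduced word over S, and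
   every such word has its value in X. *)
Definition free_basis S X : Prop :=
  set_bij (reduced_words_over S) X word_val.

End FreeGroups.

Definition free_group (G : groupType) : Prop :=
  exists S : set G, free_basis S [set: G].

Section UConstruction.
Variable G : groupType.
Implicit Types (A B D : set G) (le : rel G).

Definition total_order_on D le : Prop :=
  [/\ {in D, reflexive le}, {in D &, antisymmetric le},
      {in D & &, transitive le} & {in D &, total le}].

(* [x, y1, ..., yq] = [...[[x, y1], y2], ..., yq] *)
Definition left_normed_comm (x : G) (ys : seq G) : G :=
  foldl (@commg G) x ys.

Definition index_coherent (ls : seq (G * bool)) : Prop :=
  {in ls &, forall l l', l.1 = l'.1 -> l.2 = l'.2}.

(* b = (b, beta), a1 = (a_1, alpha_1) and s lists (a_i, alpha_i), 2 <= i <= q. *)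
Definition U_construction A B le : set G :=
  [set u | exists (b a1 : G * bool) (s : seq (G * bool)),
     [/\ (A `|` B) b.1,
         {in a1 :: s, forall l, A l.1},
         le a1.1 b.1 && (a1.1 != b.1),
         sorted le [seq l.1 | l <- a1 :: s] &
         [/\ B b.1 -> b.2 = true,
             index_coherent [:: b, a1 & s] &
             u = left_normed_comm (letter_val b)
                   [seq letter_val l | l <- a1 :: s]]]].

End UConstruction.

(* Main.v *)
From HB Require Import structures.
From Stdlib Require Import Inverse_Image.
Require Import Defs.
From mathcomp Require Import all_boot order ssralg ssrnum ssrint monoid zify.
From mathcomp.multinomials Require Import freeg.
From mathcomp Require Import boolp wochoice classical_sets functions.

(** Since X / Y is free abelian, Y is the kernel of a surjection f from X onto
a free abelian group ZI with standard basis I. The proof finds a basis of X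
adapted to f, writes down a Schreier basis of Y, and turns the latter into
the U-construction by a triangular change of basis.

The adapted basis. By the Nielsen-Schreier theorem ([subgroup_free_basis]) X has
a basis S, but nothing relates S to f. The task is to replace S by a basis which f maps in part
bijectively onto I and otherwise to 0 ([adapted_basis]). For finite S this is the
Euclidean algorithm, run with Nielsen moves. In infinite rank infinitely many
successive moves need not converge, so the moves are packed into three
changes of basis, each made at once. Close every generator alternately under
taking the support of its image and taking the letters of chosen preimages of
the elements of I: this gives S and I a common well-founded rank with finite
levels, such that the image of a generator of rank r only involves ranks at most
r, while an element of I of rank r is the image of a word in generators of rank
at most r+1. Then:
- inside the r-th level of S, Nielsen moves separate generators T_r whose
  images are independent modulo lower ranks from generators K_r whose images
  have lower rank;
- T_r and K_(r+1) together hit the r-th level of ZI modulo lower ranks: in a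
  preimage of rank at most r+1 the independent part T_(r+1) cannot
  contribute. Nielsen moves inside this finite block produce preimages of the
  standard basis modulo lower ranks, and otherwise elements of lower image;
- multiplying by words in lower blocks removes the lower terms.
The first two steps act inside disjoint blocks and the third one is triangular,
so they are invertible whatever the cardinality ([basis_change_block],
[basis_change_triangular]).

The Schreier basis. Write a_i for the generator over i in I, and B for the
generators in Y. The cosets of Y in X are the vectors v in ZI, represented by the product t_v of
the powers of the a_i in decreasing order of i. This transversal is closed under
prefixes, so Y is free on the elements t_v s t_(v+f(s))^-1, where s is a
generator and (v, s) is not one of the edges along which the transversal
grows, that is, s is not an a_i for which i is at most every index in the support
of v ([schreier_free], [transv_free]).

The U-construction. If i is at most every index in the support of v, then
t_v [x, a_i] t_v^-1 is the inverse of t_v x t_v^-1 times t_(v-i) x t_(v-i)^-1, and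
similarly for the inverse of a_i. Hence a left-normed commutator
[b, a_1, ..., a_q] with a_1 <= ... <= a_q unfolds into a product of Schreier
generators over b and their inverses, some of them trivial, with one factor for
each set of positions in the list a_1, ..., a_q; the full set gives the last one
([comm_expand]). Index coherence means that no cancellation occurs in the
vector a_1 + ... + a_q, so that sorted coherent lists correspond to vectors
([code_uniq]), and elements of B and U to Schreier generators ([coded_edgeK],
[U_elt_image]). Relative to the length of the list, B and U are thus obtained
from the Schreier basis by a triangular change ([U_basis_change]). *)

Set Implicit Arguments.
Unset Strict Implicit.
Unset Printing Implicit Defensive.

(** * Reduced words *)

Section Words.
Local Open Scope group_scope.
Variable J : choiceType.
Implicit Types (l : J * bool) (u v w : seq (J * bool)).

Definition flip l : J * bool := (l.1, ~~ l.2).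

Lemma flipK : involutive flip.
Proof. by case=> j e; rewrite /flip /= negbK. Qed.

(** Over a group this is convertible to [reduced_word]; an arbitrary alphabet is
needed because new bases are indexed by other types. *)
Definition reduced w : bool := sorted (fun l l' => l' != flip l) w.

(** Left multiplication of a reduced word by a letter. The group law on reduced
words is the action of words by [push]; associativity and inverses follow from
the fact that [push l] and [push (flip l)] are mutually inverse. *)
Definition push l w :=
  if w is l' :: w' then if l' == flip l then w' else l :: w else [:: l].

Definition wmul u w := foldr push w u.

Definition winv w := rev (map flip w).

Lemma reduced_behead l w : reduced (l :: w) -> reduced w.
Proof. by case: w => //= l' w /andP[]. Qed.

Lemma push_id l w : reduced (l :: w) -> push l w = l :: w.
Proof. by case: w => //= l' w /andP[/negbTE ->]. Qed.

Lemma reduced_push l w : reduced w -> reduced (push l w).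
Proof.
case: w => //= l' w Hw; case: ifP => [_|/negbT H]; last by rewrite /= H.
exact: reduced_behead Hw.
Qed.

Lemma pushK l w : reduced w -> push l (push (flip l) w) = w.
Proof.
case: w => [|l' w] Hw /=; first by rewrite eqxx.
rewrite flipK; case: ifP => [/eqP e|ne] /=; last by rewrite eqxx.
by rewrite -e push_id.
Qed.

Lemma reduced_wmul u w : reduced w -> reduced (wmul u w).
Proof. by move=> Hw; elim: u => //= l u IH; apply: reduced_push. Qed.

Lemma wmul_push l u w : reduced w -> wmul (push l u) w = push l (wmul u w).
Proof.
move=> Hw; case: u => //= l' u; case: ifP => //= /eqP->.
by rewrite pushK // reduced_wmul.
Qed.

Lemma wmulA u v w : reduced w -> wmul u (wmul v w) = wmul (wmul u v) w.
Proof. by move=> Hw; elim: u => //= l u ->; rewrite wmul_push. Qed.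

Lemma wmulr0 u : reduced u -> wmul u [::] = u.
Proof.
elim: u => //= l u IH H; rewrite IH ?push_id //.
exact: reduced_behead H.
Qed.

Lemma reduced_winv w : reduced w -> reduced (winv w).
Proof.
rewrite /reduced /winv rev_sorted sorted_map; apply: sub_sorted => l l' /=.
apply: contraNneq => ->; by rewrite flipK.
Qed.

Lemma wmulVw w : reduced w -> wmul (winv w) w = [::].
Proof.
elim: w => //= l w IH H; rewrite /winv map_cons rev_cons -cats1 /wmul foldr_cat.
rewrite /= flipK eqxx; exact: IH (reduced_behead H).
Qed.

Lemma winvK : involutive winv.
Proof.
move=> w; rewrite /winv map_rev revK -map_comp map_id_in // => l _ /=.
exact: flipK.
Qed.

Lemma wmul_letters (P : J -> Prop) u v : {in u, forall l, P l.1} ->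
  {in v, forall l, P l.1} -> {in wmul u v, forall l, P l.1}.
Proof.
move=> + Pv; elim: u => //= l u IH Pu k.
have {IH}IH : {in wmul u v, forall l, P l.1}.
  by apply: IH => i iv; apply: Pu; rewrite inE iv orbT.
have Pl : P l.1 := Pu l (mem_head _ _).
rewrite /push; case: (wmul u v) IH => [|l' v'] IH; first by rewrite inE => /eqP->.
case: ifP => _; first by move=> kv; apply: IH; rewrite inE kv orbT.
by rewrite inE => /orP[/eqP->|/IH].
Qed.

Record free_grp := FreeGrp { fword :> seq (J * bool); _ : reduced fword }.
HB.instance Definition _ := [isSub for fword].
HB.instance Definition _ := [Choice of free_grp by <:].

Lemma fwordP (x : free_grp) : reduced x. Proof. by case: x. Qed.

Definition free_mul (x y : free_grp) := FreeGrp (reduced_wmul x (fwordP y)).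
Definition free_one := @FreeGrp [::] isT.
Definition free_inv (x : free_grp) := FreeGrp (reduced_winv (fwordP x)).

Fact free_mulA : associative free_mul.
Proof. by move=> x y z; apply: val_inj; apply: wmulA (fwordP z). Qed.
Fact free_mul1 : left_id free_one free_mul.
Proof. by move=> x; apply: val_inj. Qed.
Fact free_mulr1 : right_id free_one free_mul.
Proof. by move=> x; apply: val_inj; apply: wmulr0 (fwordP x). Qed.
Fact free_mulV : left_inverse free_one free_inv free_mul.
Proof. by move=> x; apply: val_inj; apply: wmulVw (fwordP x). Qed.
Fact free_mulVr : right_inverse free_one free_inv free_mul.
Proof.
move=> x; apply: val_inj; rewrite /= -{1}(winvK (fword x)).
exact: wmulVw (reduced_winv (fwordP x)).
Qed.

HB.instance Definition _ := isGroup.Build free_grp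
  free_mulA free_mul1 free_mulr1 free_mulV free_mulVr.

Definition free_gen (j : J) : free_grp := @FreeGrp [:: (j, true)] isT.

End Words.

Section Eval.
Local Open Scope group_scope.
Variables (J : choiceType) (G : groupType).
Implicit Types (y : J -> G) (w : seq (J * bool)).

Definition lval y (l : J * bool) : G := if l.2 then y l.1 else (y l.1)^-1.
Definition wval y w : G := \prod_(l <- w) lval y l.

Lemma wval_nil y : wval y [::] = 1. Proof. exact: big_nil. Qed.
Lemma wval_cons y l w : wval y (l :: w) = lval y l * wval y w.
Proof. exact: big_cons. Qed.
Lemma wval_cat y u w : wval y (u ++ w) = wval y u * wval y w.
Proof. exact: big_cat. Qed.

Lemma lval_flip y l : lval y (flip l) = (lval y l)^-1.
Proof. by rewrite /lval /=; case: l => j [] /=; rewrite ?invgK. Qed.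

Lemma wval_inv y w : wval y (winv w) = (wval y w)^-1.
Proof.
elim: w => [|l w IH]; first by rewrite /winv /= wval_nil invg1.
rewrite /winv map_cons rev_cons -cats1 wval_cat -/(winv w) IH.
by rewrite !wval_cons wval_nil mulg1 lval_flip invgM.
Qed.

Lemma wval_push y l w : wval y (push l w) = lval y l * wval y w.
Proof.
case: w => [|l' w] /=; first by rewrite wval_cons.
case: ifP => [/eqP-> |_]; last by rewrite wval_cons.
by rewrite wval_cons lval_flip mulVKg.
Qed.

Lemma wval_wmul y u w : wval y (wmul u w) = wval y u * wval y w.
Proof.
elim: u => [|l u IH] /=; first by rewrite wval_nil mul1g.
by rewrite wval_push IH wval_cons mulgA.
Qed.

Lemma eq_wval y z w : {in w, forall l, y l.1 = z l.1} -> wval y w = wval z w.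
Proof.
move=> H; rewrite /wval; apply: eq_big_seq => l /H; by rewrite /lval => ->.
Qed.

End Eval.

Lemma wval_gen (J : choiceType) (w : seq (J * bool)) :
  reduced w -> fword (wval (@free_gen J) w) = w.
Proof.
move=> /wmulr0 {2}<-; elim: w => [|[j e] w IH] /=; first by rewrite wval_nil.
rewrite wval_cons -IH; case: e => /=; rewrite /lval /=; by [].
Qed.

(** * Families of elements, freeness and free bases *)

Section Subgroup.
Local Open Scope group_scope.
Local Open Scope classical_set_scope.
Variable G : groupType.
Implicit Types (X : set G).

Lemma subgroupP X : subgroup X <->
  [/\ X 1, forall x y, X x -> X y -> X (x * y) & forall x, X x -> X x^-1].
Proof.
rewrite /subgroup; split=> [XG|[X1 XM XV]].
  have [X1 _] := XG; split=> [|x y Xx Xy|x Xx]; first by rewrite inE in X1.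
    by have := group_closedM XG (mem_set Xx) (mem_set Xy); rewrite inE.
  by have := group_closedV XG (mem_set Xx); rewrite inE.
split=> [|x y]; rewrite ?inE // => Xx Xy; exact: XM (XV _ _).
Qed.

Lemma subgroup1 X : subgroup X -> X 1. Proof. by case/subgroupP. Qed.
Lemma subgroupM X x y : subgroup X -> X x -> X y -> X (x * y).
Proof. by case/subgroupP=> _ + _; apply. Qed.
Lemma subgroupV X x : subgroup X -> X x -> X x^-1.
Proof. by case/subgroupP=> _ _; apply. Qed.

Definition hom_on (H : groupType) X (phi : G -> H) :=
  forall x y, X x -> X y -> phi (x * y) = phi x * phi y.

Section HomOn.
Variables (H : groupType) (X : set G) (phi : G -> H).
Hypotheses (XG : subgroup X) (phiM : hom_on X phi).

Lemma hom_on1 : phi 1 = 1.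
Proof.
have := phiM (subgroup1 XG) (subgroup1 XG); rewrite mulg1 => /(congr1 (mul _^-1)).
by move/(_ (phi 1)); rewrite mulVg mulKg.
Qed.

Lemma hom_onV x : X x -> phi x^-1 = (phi x)^-1.
Proof.
move=> Xx; apply: (mulgI (phi x)); rewrite mulgV -phiM ?mulgV ?hom_on1 //.
exact: subgroupV.
Qed.
End HomOn.
End Subgroup.

Section Families.
Local Open Scope group_scope.
Local Open Scope classical_set_scope.
Variables (J : choiceType) (G : groupType).
Implicit Types (P Q : set J) (y z : J -> G) (X : set G).

(** The subgroup generated by a family, in terms of words over the index type:
a homomorphism is then computed letter by letter ([hom_on_wval]), even
before the family is known to be injective. *)
Definition span P y : set G :=
  [set x | exists2 w, {in w, forall l, P l.1} & x = wval y w].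

Lemma span1 P y : span P y 1.
Proof. by exists [::]; rewrite ?wval_nil. Qed.

Lemma span_gen P y j : P j -> span P y (y j).
Proof.
move=> Pj; exists [:: (j, true)] => [l|]; first by rewrite inE => /eqP->.
by rewrite wval_cons wval_nil mulg1.
Qed.

Lemma spanM P y a b : span P y a -> span P y b -> span P y (a * b).
Proof.
case=> u Hu -> [v Hv ->]; exists (u ++ v); rewrite ?wval_cat // => l.
by rewrite mem_cat => /orP[/Hu|/Hv].
Qed.

Lemma spanV P y a : span P y a -> span P y a^-1.
Proof.
case=> u Hu ->; exists (winv u); rewrite ?wval_inv // => l.
by rewrite mem_rev => /mapP[k /Hu Pk ->].
Qed.

Lemma span_subgroup P y : subgroup (span P y).
Proof. by apply/subgroupP; split; [exact: span1|exact: spanM|exact: spanV]. Qed.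

Lemma span_min P y X : subgroup X -> (forall j, P j -> X (y j)) -> span P y `<=` X.
Proof.
move=> XG Xy _ [w Pw ->]; elim: w Pw => [|l w IH] Pw.
  by rewrite wval_nil; apply: subgroup1.
rewrite wval_cons; apply: subgroupM => //; last first.
  by apply: IH => k kw; apply: Pw; rewrite inE kw orbT.
have /Xy := Pw l (mem_head _ _); rewrite /lval; case: ifP => // _.
exact: subgroupV.
Qed.

Lemma span_sub P Q y z :
  (forall j, P j -> span Q z (y j)) -> span P y `<=` span Q z.
Proof. exact: span_min (@span_subgroup Q z). Qed.

Lemma spanS P Q y : P `<=` Q -> span P y `<=` span Q y.
Proof. by move=> PQ; apply: span_sub => j /PQ; apply: span_gen. Qed.

Lemma eq_span P y z : (forall j, P j -> y j = z j) -> span P y = span P z.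
Proof.
move=> e; apply/seteqP; split; apply: span_sub => j Pj.
  by rewrite e //; apply: span_gen.
by rewrite -e //; apply: span_gen.
Qed.

Lemma hom_on_wval (H : groupType) (phi : G -> H) h P y w :
  hom_on (span P y) phi -> (forall j, P j -> phi (y j) = h j) ->
  {in w, forall l, P l.1} -> phi (wval y w) = wval h w.
Proof.
move=> phiM phiy; elim: w => [|l w IH] Pw.
  by rewrite !wval_nil (hom_on1 (@span_subgroup P y)).
have Pl : P l.1 by apply: Pw (mem_head _ _).
have Pw' : {in w, forall l, P l.1}.
  by move=> k kw; apply: Pw; rewrite inE kw orbT.
rewrite !wval_cons phiM; first last.
- by exists w.
- by rewrite /lval; case: ifP => _; [|apply: spanV]; apply: span_gen.
rewrite IH //; congr (_ * _); rewrite /lval; case: ifP => _; rewrite -phiy //.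
exact: (hom_onV (@span_subgroup P y) phiM) (span_gen _ _).
Qed.

(** Freeness as a universal property. It is stated for indexed families because
a change of basis keeps the indices while it moves the elements. *)
Definition free_family P y := forall (H : groupType) (g : J -> H),
  exists phi : G -> H, hom_on (span P y) phi /\ forall j, P j -> phi (y j) = g j.

(** Mapping the family to the generators of the abstract free group recovers a
reduced word from its value. *)
Lemma free_family_word P y u v : free_family P y ->
  reduced u -> reduced v -> {in u, forall l, P l.1} -> {in v, forall l, P l.1} ->
  wval y u = wval y v -> u = v.
Proof.
move=> /(_ _ (@free_gen J))[phi [phiM phiy]] Ru Rv Pu Pv e.
rewrite -(wval_gen Ru) -(wval_gen Rv); congr fword.
by rewrite -!(hom_on_wval phiM phiy) // e.
Qed.

Lemma free_family_inj P y : free_family P y ->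
  forall i j, P i -> P j -> y i = y j -> i = j.
Proof.
move=> yfree i j Pi Pj e.
suff [] : [:: (i, true)] = [:: (j, true)] by [].
apply: (free_family_word yfree) => // [l|l|]; try by rewrite inE => /eqP->.
by rewrite !wval_cons !wval_nil /lval /= e.
Qed.
End Families.

Section FreeBasis.
Local Open Scope group_scope.
Local Open Scope classical_set_scope.
Variables (G : groupType).
Implicit Types (S X : set G).

Lemma free_family_basis (J : choiceType) (P : set J) (y : J -> G) :
  free_family P y -> free_basis (y @` P) (span P y).
Proof.
move=> yfree.
have liftw (w : seq (G * bool)) : {in w, forall l, (y @` P) l.1} ->
    exists2 u : seq (J * bool), {in u, forall l, P l.1} &
      w = [seq (y l.1, l.2) | l <- u].
  elim: w => [|l w IH] Hw; first by exists [::].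
  have [k kw|u Pu ->] := IH; first by apply: Hw; rewrite inE kw orbT.
  have [j Pj e] := Hw l (mem_head _ _).
  exists ((j, l.2) :: u); last by rewrite /= e; case: (l).
  by move=> k; rewrite inE => /orP[/eqP->|/Pu].
have redw (u : seq (J * bool)) :
    reduced_word [seq (y l.1, l.2) | l <- u] -> reduced u.
  rewrite /reduced_word sorted_map; apply: sub_sorted => l l' /=.
  by apply: contraNneq => ->.
have valw (u : seq (J * bool)) :
    word_val [seq (y l.1, l.2) | l <- u] = wval y u.
  by rewrite /word_val big_map.
split.
- move=> w [/liftw[u Pu ->] _]; rewrite valw; by exists u.
- move=> w w'; rewrite !inE => -[/liftw[u Pu ->] /redw Ru].
  move=> [/liftw[v Pv ->] /redw Rv]; rewrite !valw => e.
  by rewrite (free_family_word yfree Ru Rv Pu Pv e).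
move=> _ [w Pw ->].
pose u := wmul w [::].
have Ru : reduced u by apply: reduced_wmul.
have Pu : {in u, forall l, P l.1} by apply: wmul_letters.
exists [seq (y l.1, l.2) | l <- u]; last first.
  by rewrite valw /u wval_wmul wval_nil mulg1.
split=> [_ /mapP[l /Pu Pl ->] /=|]; first by exists l.1.
rewrite /reduced_word sorted_map.
have Pu' : all (mem [set l | P l.1]) u.
  by apply/allP => l /Pu Pl; rewrite inE.
apply: (sub_in_sorted _ Pu' Ru) => l l'; rewrite !inE /= => Pl Pl'.
apply: contraNneq => -[e1 e2]; case: l l' Pl Pl' e1 e2 => [i a] [j b] /=.
by move=> Pi Pj /(free_family_inj yfree Pj Pi)-> ->.
Qed.

Lemma span_basis S X : subgroup X -> free_basis S X -> span S id = X.
Proof.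
move=> XG [SX Sinj Ssurj]; apply/seteqP; split=> x.
  apply: (span_min XG) => s Ss.
  have := SX [:: (s, true)]; rewrite /word_val big_seq1; apply; split=> // l.
  by rewrite inE => /eqP->.
by move/Ssurj => [w [Sw _] <-]; exists w.
Qed.

Section Cocycle.
Variables (X : set G) (H : groupType) (c : G -> G -> H).
Hypothesis XG : subgroup X.
Hypothesis cM : forall x u v, X u -> X v -> c x (u * v) = c x u * c (x * u) v.

Lemma cocycle1 x : c x 1 = 1.
Proof.
have := cM x (subgroup1 XG) (subgroup1 XG); rewrite !mulg1 => e.
by apply: (mulgI (c x 1)); rewrite mulg1 -e.
Qed.

Lemma cocycleV x u : X u -> c x u^-1 = (c (x * u^-1) u)^-1.
Proof.
move=> Xu; have := cM x (subgroupV XG Xu) Xu.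
by rewrite mulVg cocycle1 => /esym/eqP; rewrite mulg_eq1 => /eqP.
Qed.
End Cocycle.

(** Arbitrary labels on the edges (x, x s) of the Cayley graph can be read along
the path from x spelled by a reduced word; inserting or cancelling inverse
letters does not change the product of the labels. Labels which depend on x are
what the Schreier argument needs; for labels independent of x the cocycle
is a homomorphism. *)
Lemma free_basis_cocycle S X (H : groupType) (lab : G -> G -> H) :
  subgroup X -> free_basis S X ->
  exists c : G -> G -> H,
    (forall x s, S s -> c x s = lab x s) /\
    (forall x u v, X u -> X v -> c x (u * v) = c x u * c (x * u) v).
Proof.
move=> XG SB; have [SX Sinj Ssurj] := SB.
pose step (l : G * bool) x : H :=
  if l.2 then lab x l.1 else (lab (x * l.1^-1) l.1)^-1.
pose fix run x (w : seq (G * bool)) : H :=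
  if w is l :: w' then step l x * run (x * lval id l) w' else 1.
have run_push l w x : run x (push l w) = step l x * run (x * lval id l) w.
  case: w => [|l' w] //=; case: ifP => [/eqP->|] //=.
  rewrite lval_flip mulgK; case: l => s [] /=; rewrite /step /lval /=.
    by rewrite mulgK mulVKg.
  by rewrite mulKg.
have run_wmul u w x : run x (wmul u w) = run x u * run (x * wval id u) w.
  elim: u x => [|l u IH] x /=; first by rewrite mul1g wval_nil mulg1.
  by rewrite run_push IH wval_cons !mulgA.
have wordX x : X x -> {w : seq (G * bool) | [/\ {in w, forall l, S l.1},
     reduced w & wval id w = x]}.
  by move=> /Ssurj Hx; apply: cid; case: Hx => w [Sw Rw] <-; exists w.
pose word x : seq (G * bool) :=
  if pselect (X x) is left Xx then sval (wordX x Xx) else [::].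
have wordP x : X x -> [/\ {in word x, forall l, S l.1},
     reduced (word x) & wval id (word x) = x].
  by rewrite /word; case: pselect => // Xx _; exact: (svalP (wordX x Xx)).
have word_uniq x w : X x -> {in w, forall l, S l.1} -> reduced w ->
    wval id w = x -> word x = w.
  move=> Xx Sw Rw e; have [Sx Rx ex] := wordP x Xx.
  by apply: Sinj; rewrite ?inE //; exact: etrans ex (esym e).
exists (fun x v => run x (word v)); split.
  move=> x s Ss; have Hs : {in [:: (s, true)], forall l : G * bool, S l.1}.
    by move=> l; rewrite inE => /eqP->.
  rewrite (@word_uniq s [:: (s, true)]) //=; first by rewrite mulg1.
    have := SX [:: (s, true)]; rewrite /word_val big_seq1; apply; by split.
  by rewrite wval_cons wval_nil mulg1.
move=> x u v Xu Xv; have [Su Ru eu] := wordP u Xu; have [Sv Rv ev] := wordP v Xv.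
rewrite (@word_uniq (u * v) (wmul (word u) (word v))).
- by rewrite run_wmul eu.
- exact: subgroupM.
- exact: wmul_letters.
- exact: reduced_wmul.
by rewrite wval_wmul eu ev.
Qed.

Lemma free_basis_family S X : subgroup X -> free_basis S X -> free_family S id.
Proof.
move=> XG SB H g; have SX := span_basis XG SB.
have [c [cS cM]] := free_basis_cocycle (fun _ s => g s) XG SB.
have c1 := cocycle1 XG cM; have cV := cocycleV XG cM.
have cc u : X u -> forall x, c x u = c 1 u.
  rewrite -SX => -[w Sw ->]; elim: w Sw => [|l w IH] Sw x.
    by rewrite wval_nil !c1.
  have Sl : S l.1 := Sw l (mem_head _ _).
  have Xl : X l.1 by rewrite -SX; apply: (@span_gen _ _ S id).
  have {}IH : forall x, c x (wval id w) = c 1 (wval id w).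
    by apply: IH => k kw; apply: Sw; rewrite inE kw orbT.
  have Xw : X (wval id w).
    by rewrite -SX; exists w => // k kw; apply: Sw; rewrite inE kw orbT.
  have Xl' : X (lval id l).
    by rewrite /lval; case: ifP => _ //; apply: subgroupV.
  rewrite wval_cons !cM // IH [in RHS]IH; congr (_ * _).
  by rewrite /lval; case: ifP => _; rewrite ?cV // !cS.
exists (c 1); split=> [u v|s Ss]; last by rewrite cS.
by rewrite SX => Xu Xv; rewrite cM // cc // -{2}(cc _ Xv 1).
Qed.
End FreeBasis.

(** * Schreier generators *)

Section Schreier.
Local Open Scope group_scope.
Local Open Scope classical_set_scope.
Variables (G : groupType) (S X Y : set G) (O : choiceType).
Variables (f : G -> O) (rep : O -> G) (Tr : O -> G -> Prop) (ht : O -> nat).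
Hypotheses (XG : subgroup X) (SB : free_basis S X).
Hypotheses (YG : subgroup Y) (YX : Y `<=` X).
Hypothesis fP : forall x y, X x -> X y -> f x = f y <-> Y (x * y^-1).
Hypothesis repX : forall x, X x -> X (rep (f x)).
Hypothesis repK : forall x, X x -> f (rep (f x)) = f x.
Hypothesis rep1 : rep (f 1) = 1.
Hypothesis TrP : forall x s, X x -> S s -> Tr (f x) s ->
  rep (f x) * s = rep (f (rep (f x) * s)).
Hypothesis treeP : forall x, X x -> rep (f x) = 1 \/
  exists x' s, [/\ X x', S s, (ht (f x') < ht (f x))%N &
    (Tr (f x') s /\ rep (f x) = rep (f x') * s) \/
    (Tr (f x) s /\ rep (f x) * s = rep (f x'))].

(** The map [f] names the right cosets of [Y] in [X], [rep] picks a representative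
in each of them, and [Tr] marks the edges of the coset graph that belong to a
spanning tree: [treeP] says that every representative is obtained from one of
smaller height by following such an edge forwards or backwards. *)
Definition schreier_edges : set (O * G) :=
  [set e | [/\ (f @` X) e.1, S e.2 & ~ Tr e.1 e.2]].

Definition schreier_gen (e : O * G) : G :=
  rep e.1 * e.2 * (rep (f (rep e.1 * e.2)))^-1.

Let SX : span S id = X. Proof. exact: span_basis XG SB. Qed.

Let S_X s : S s -> X s.
Proof. by rewrite -SX; apply: (@span_gen _ _ S id). Qed.

Let X_ind (K : set G) : subgroup K -> S `<=` K -> X `<=` K.
Proof. by move=> KG SK; rewrite -SX; apply: span_min. Qed.

Let fM x y u : X x -> X y -> X u -> f x = f y -> f (x * u) = f (y * u).
Proof.
move=> Xx Xy Xu /(fP Xx Xy) Yxy; apply/fP; try exact: subgroupM.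
by rewrite invgM mulgA mulgK.
Qed.

(** The words x for which every rep(u) x rep(ux)^-1 is a product of Schreier
generators form a subgroup containing [S]; take u = 1 and x in [Y]. *)
Lemma schreier_span : span schreier_edges schreier_gen = Y.
Proof.
apply/seteqP; split.
  apply: (span_min YG) => -[C s] [] /= [x Xx <-] Ss _.
  have Xr : X (rep (f x) * s) := subgroupM XG (repX Xx) (S_X Ss).
  by rewrite /schreier_gen /=; apply/(fP Xr (repX Xr)); rewrite repK.
(* Quantifying over all u makes the property stable under products. *)
pose K : set G := [set x | X x /\ forall u, X u ->
  span schreier_edges schreier_gen (rep (f u) * x * (rep (f (u * x)))^-1)].
have KX : X `<=` K.
  apply: X_ind.
    apply/subgroupP; split.
    - by split=> [|u Xu]; rewrite ?mulg1 ?mulgV; [exact: subgroup1|exact: span1].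
    - move=> x y [Xx Kx] [Xy Ky]; split=> [|u Xu]; first exact: subgroupM.
      have Xux : X (u * x) by apply: subgroupM.
      have := spanM (Kx u Xu) (Ky _ Xux).
      by rewrite !mulgA mulgVK.
    move=> x [Xx Kx]; split=> [|u Xu]; first exact: subgroupV.
    have Xux : X (u * x^-1) by apply: subgroupM => //; apply: subgroupV.
    by have := spanV (Kx _ Xux); rewrite mulgVK !invgM invgK mulgA.
  move=> s Ss; split=> [|u Xu]; first exact: S_X.
  have e : f (u * s) = f (rep (f u) * s).
    by apply: fM; rewrite ?repK //; [apply: repX|apply: S_X].
  rewrite e; case: (pselect (Tr (f u) s)) => [tr|ntr].
    by rewrite -TrP // mulgV; apply: span1.
  by apply: (@span_gen _ _ _ schreier_gen (f u, s)); split=> //; exists u.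
move=> y Yy; have [Xy /(_ _ (subgroup1 XG))] := KX y (YX Yy).
have -> : f (1 * y) = f 1.
  by rewrite mul1g; apply/(fP Xy (subgroup1 XG)); rewrite invg1 mulg1.
by rewrite rep1 invg1 mul1g mulg1.
Qed.

(** Label tree edges by 1 and any other edge by the prescribed value, and let c be
the resulting cocycle. It depends on the starting point only through its coset,
so c(1, .) is a homomorphism on [Y]. It is trivial on representatives, as
these are spelled along the tree, and therefore takes the prescribed value on
each Schreier generator. *)
Lemma schreier_free : free_family schreier_edges schreier_gen.
Proof.
move=> H g; rewrite schreier_span.
pose lab x s := if `[< Tr (f x) s >] then 1 else g (f x, s).
have [c [cS cM]] := free_basis_cocycle lab XG SB.
have X1 := subgroup1 XG.
have XM := fun x y => @subgroupM _ _ x y XG.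
have XV := fun x => @subgroupV _ _ x XG.
have c1 := cocycle1 XG cM; have cV := cocycleV XG cM.
have cf u : X u -> forall x y, X x -> X y -> f x = f y -> c x u = c y u.
  pose K : set G := [set u | X u /\
    forall x y, X x -> X y -> f x = f y -> c x u = c y u].
  suff KX : X `<=` K by move=> /KX[].
  apply: X_ind.
    apply/subgroupP; split.
    - by split=> // x y; rewrite !c1.
    - move=> v w [Xv Kv] [Xw Kw]; split=> [|x y Xx Xy e]; first exact: XM.
      rewrite !cM // (Kv x y) //; congr (_ * _).
      by apply: Kw; [exact: XM|exact: XM|exact: fM].
    move=> v [Xv Kv]; split=> [|x y Xx Xy e]; first exact: XV.
    have Xv' := XV _ Xv.
    by rewrite !cV //; congr _^-1; apply: Kv; [exact: XM|exact: XM|exact: fM].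
  move=> s Ss; split=> [|x y Xx Xy e]; first exact: S_X.
  by rewrite !cS // /lab e.
have crep x : X x -> c 1 (rep (f x)) = 1.
  have [n] := ubnP (ht (f x)); elim: n x => // n IH x lt_n Xx.
  have [->|[x' [s [Xx' Ss lt_x tr]]]] := treeP Xx; first exact: c1.
  have {lt_x}/IH/(_ Xx') IHx' : (ht (f x') < n)%N by apply: leq_trans lt_x _.
  have Xs := S_X Ss; have Xr := repX Xx; have Xr' := repX Xx'.
  case: tr => [[tr ->]|[tr e]].
    by rewrite cM // IHx' !mul1g cS // /lab /= repK // asboolT.
  move: IHx'; rewrite -e cM // mul1g (cS _ s) // /lab /= repK // asboolT //.
  by rewrite mulg1.
exists (c 1); split=> [u v Yu Yv|[C s] [] /= [x Xx <-] Ss ntr].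
  have [Xu Xv] := (YX Yu, YX Yv); rewrite cM // mul1g; congr (_ * _).
  by apply: cf => //; apply/(fP Xu X1); rewrite invg1 mulg1.
have [Xs Xr] := (S_X Ss, repX Xx); have Xrs := XM _ _ Xr Xs.
have Xq := repX Xrs.
rewrite /schreier_gen /= cM ?cM //; try exact: XV.
rewrite !mul1g crep // mul1g cS // /lab /= repK // asboolF //.
rewrite (cf _ (XV _ Xq) _ _ Xrs Xq (esym (repK Xrs))).
by rewrite cV // mulgV crep // invg1 mulg1.
Qed.

End Schreier.

(** * Subgroups of free groups are free *)

Section NielsenSchreier.
Local Open Scope group_scope.
Local Open Scope classical_set_scope.
Variables (F : groupType) (S X : set F).
Hypotheses (SB : free_basis S [set: F]) (XG : subgroup X).

Let f (x : F) : set F := [set z | X (z * x^-1)].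

Let fP x y : f x = f y <-> X (x * y^-1).
Proof.
split=> [e|Xxy].
  have : f x x by rewrite /f /= mulgV; apply: subgroup1.
  by rewrite e.
apply/seteqP; split=> z; rewrite /f /= => Xz.
  by have := subgroupM XG Xz Xxy; rewrite mulgA mulgVK.
have := subgroupM XG Xz (subgroupV XG Xxy).
by rewrite invgF mulgA mulgVK.
Qed.

Let fM x y u : f x = f y -> f (x * u) = f (y * u).
Proof. by move/fP => Xxy; apply/fP; rewrite invgM mulgA mulgK. Qed.

Let reach (C : set F) n := exists w : seq (F * bool),
  [/\ {in w, forall l, S l.1}, size w = n & f (wval id w) = C].
Let ht C := xget 0%N [set n | reach C n /\ forall m, reach C m -> (n <= m)%N].

Let TG : subgroup [set: F]. Proof. by apply/subgroupP. Qed.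

Let htP x : reach (f x) (ht (f x)) /\ forall m, reach (f x) m -> (ht (f x) <= m)%N.
Proof.
rewrite /ht; case: xgetP => [n _ //|no].
have : exists n, `[< reach (f x) n >].
  have : span S id x by rewrite (span_basis TG SB).
  by move=> [w Sw ->]; exists (size w); apply/asboolP; exists w.
move=> ex; case: (ex_minnP ex) => n /asboolP rn min; case: (no n).
by split=> // m rm; apply: min; apply/asboolP.
Qed.

Let parent_ex C : exists p : F * (F * bool), 0 < ht C -> (exists x, C = f x) ->
  [/\ S p.2.1, (ht (f p.1)).+1 = ht C & f (p.1 * lval id p.2) = C].
Proof.
have [[h [x e]]|no] := pselect (0 < ht C /\ exists x, C = f x); last first.
  by exists (1, (1, true)) => h x; case: no.
have [[w [Sw sw fw]] min] := htP x; rewrite -e in sw fw min.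
case/lastP: w Sw sw fw => [|w l] Sw sw fw; first by rewrite -sw in h.
have Sl : S l.1 by apply: Sw; rewrite mem_rcons mem_head.
exists (wval id w, l) => _ _; split=> //=; last first.
  by rewrite -fw -cats1 wval_cat wval_cons wval_nil mulg1.
rewrite size_rcons in sw; rewrite -sw; congr _.+1.
have [[w' [Sw' sw' fw']] min'] := htP (wval id w); apply/eqP; rewrite eqn_leq.
rewrite min' /=; last first.
  by exists w; split=> // k kw; apply: Sw; rewrite mem_rcons inE kw orbT.
rewrite -ltnS sw -sw' -(size_rcons w' l); apply: min; exists (rcons w' l).
split=> // [k|]; first by rewrite mem_rcons inE => /orP[/eqP->|/Sw'].
rewrite -fw -!cats1 !wval_cat; exact: fM.
Qed.

Let par C := sval (cid (parent_ex C)).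
Let parP x : 0 < ht (f x) -> [/\ S (par (f x)).2.1,
  (ht (f (par (f x)).1)).+1 = ht (f x) &
  f ((par (f x)).1 * lval id (par (f x)).2) = f x].
Proof. by move=> h; apply: (svalP (cid (parent_ex (f x)))) => //; exists x. Qed.

Let Fixpoint rp n (C : set F) : F :=
  if n is n'.+1 then rp n' (f (par C).1) * lval id (par C).2 else 1.
Let rep C := rp (ht C) C.

Let repS x : 0 < ht (f x) ->
  rep (f x) = rep (f (par (f x)).1) * lval id (par (f x)).2.
Proof. by move=> h; have [_ e _] := parP h; rewrite /rep -e. Qed.

Let ht0 x : ht (f x) = 0%N -> f x = f 1.
Proof.
have [[w [Sw sw fw]] _] := htP x; move=> e; rewrite e in sw.
by move/size0nil: sw fw => ->; rewrite wval_nil.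
Qed.

Let repK x : f (rep (f x)) = f x.
Proof.
have [n] := ubnP (ht (f x)); elim: n x => // n IH x lt_n.
have [e|h] := posnP (ht (f x)); first by rewrite /rep e /= ht0.
have [_ e1 e2] := parP h; rewrite repS // -[RHS]e2.
by apply: fM; apply: IH; rewrite e1.
Qed.

(** Nielsen-Schreier. The spanning tree is made of shortest words: the height of
a coset is the least length of a word reaching it, and [par] chooses a last
step of such a word. *)
Lemma subgroup_free_basis : exists S' : set F, free_basis S' X.
Proof.
pose Tr C s := rep C * s = rep (f (rep C * s)).
have rep1 : rep (f 1) = 1.
  rewrite /rep; suff -> : ht (f 1) = 0%N by [].
  apply/eqP; rewrite -leqn0; case: (htP 1) => _; apply.
  by exists [::]; rewrite wval_nil.
have treeP x : [set: F] x -> rep (f x) = 1 \/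
  exists x' s, [/\ [set: F] x', S s, (ht (f x') < ht (f x))%N &
    (Tr (f x') s /\ rep (f x) = rep (f x') * s) \/
    (Tr (f x) s /\ rep (f x) * s = rep (f x'))].
  move=> _; have [e|h] := posnP (ht (f x)); [left|right].
    by rewrite (ht0 e).
  have [Sl e1 e2] := parP h; have := repS h; move: Sl e1 e2.
  case: (par (f x)) => x' [s e] /= Ss e1 e2 e3.
  exists x', s; split=> //; first by rewrite -e1.
  case: e e2 e3; rewrite /lval /= => e2 e3; [left|right].
    by split=> //; rewrite /Tr -e3 repK.
  have {}e3 : rep (f x) * s = rep (f x') by rewrite e3 mulgVK.
  by split=> //; rewrite /Tr e3 repK.
have fP' x y : [set: F] x -> [set: F] y -> f x = f y <-> X (x * y^-1).
  by move=> _ _; apply: fP.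
have XT : X `<=` [set: F] by [].
have repT x : [set: F] x -> [set: F] (rep (f x)) by [].
have repKT x : [set: F] x -> f (rep (f x)) = f x by move=> _; apply: repK.
have TrP x s : [set: F] x -> S s -> Tr (f x) s ->
  rep (f x) * s = rep (f (rep (f x) * s)) by [].
have Xfree := schreier_free TG SB XG XT fP' repT repKT rep1 TrP treeP.
have Xspan := schreier_span TG SB XG XT fP' repT repKT rep1 TrP.
by eexists; rewrite -Xspan; apply: free_family_basis Xfree.
Qed.

End NielsenSchreier.

(** * Changes of basis *)

Section BasisChange.
Local Open Scope group_scope.
Local Open Scope classical_set_scope.
Variables (J : choiceType) (G : groupType).
Implicit Types (P Q : set J) (y z : J -> G).

(** The family z generates the same subgroup as y, and prescribing values on z
amounts to prescribing values on y. No freeness is assumed, so the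
moves can be studied inside finite blocks on their own and combined afterwards. *)
Definition basis_change P y z : Prop :=
  span P z = span P y /\
  forall (H : groupType) (g : J -> H), exists h : J -> H, forall phi : G -> H,
    hom_on (span P y) phi -> (forall j, P j -> phi (y j) = h j) ->
    forall j, P j -> phi (z j) = g j.

Lemma basis_change_free P y z :
  basis_change P y z -> free_family P y -> free_family P z.
Proof.
move=> [e bc] yfree H g; have [h hP] := bc H g; have [phi [phiM phiy]] := yfree H h.
by exists phi; rewrite e; split=> //; apply: hP.
Qed.

Lemma basis_change_eq P y z : (forall j, P j -> y j = z j) -> basis_change P y z.
Proof.
move=> e; split=> [|H g]; first exact/esym/eq_span.
by exists g => phi _ phiy j Pj; rewrite -e // phiy.
Qed.

Lemma basis_change_trans P y z t :
  basis_change P y z -> basis_change P z t -> basis_change P y t.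
Proof.
move=> [e1 bc1] [e2 bc2]; split=> [|H g]; first by rewrite e2.
have [h2 h2P] := bc2 H g; have [h1 h1P] := bc1 H h2; exists h1 => phi phiM phiy.
apply: h2P; first by rewrite e1.
exact: h1P.
Qed.

(** Infinitely many changes can be made at once if they concern disjoint blocks. *)
Lemma basis_change_block (T : Type) (p : J -> T) P y z :
  (forall t, basis_change [set j | P j /\ p j = t] y z) -> basis_change P y z.
Proof.
move=> bc; have sub t : [set j | P j /\ p j = t] `<=` P by move=> j [].
split=> [|H g].
  apply/seteqP; split; apply: span_sub => j Pj; have [e _] := bc (p j).
    by apply: (spanS (sub (p j))); rewrite -e; apply: span_gen.
  by apply: (spanS (sub (p j))); rewrite e; apply: span_gen.
have [h hP] := choice (fun t => (bc t).2 H g).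
exists (fun j => h (p j) j) => phi phiM phiy j Pj.
apply: (hP (p j)) => //.
  by move=> u v /(spanS (sub _)) ? /(spanS (sub _)) ?; apply: phiM.
by move=> i [Pi <-]; apply: phiy.
Qed.

(** The values to be prescribed on y are found by recursion along [R], because
the image of W_j under a homomorphism only depends on the values on smaller
indices, as one sees on a word for W_j. *)
Lemma basis_change_triangular (R : J -> J -> Prop) (W : J -> G) (e : J -> bool) P y z :
  well_founded R ->
  (forall j, P j -> span [set i | P i /\ R i j] y (W j)) ->
  (forall j, P j -> z j = W j * (if e j then y j else (y j)^-1)) ->
  basis_change P y z.
Proof.
move=> Rwf Wy zE.
have sub j : [set i | P i /\ R i j] `<=` P by move=> i [].
have ez j : P j -> y j = if e j then (W j)^-1 * z j else (z j)^-1 * W j.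
  by move/zE => ->; case: (e j); rewrite ?mulKg // invgM invgK mulgVK.
split=> [|H g].
  apply/seteqP; split; apply: span_sub => j Pj.
    rewrite zE //; apply: spanM; first exact: (spanS (sub j)) (Wy j Pj).
    by case: ifP => _; [|apply: spanV]; apply: span_gen.
  elim/(well_founded_ind Rwf): j Pj => j IH Pj.
  have Wz : span P z (W j).
    by apply: span_sub (Wy j Pj) => i [Pi Rij]; apply: IH.
  rewrite ez //; case: ifP => _; apply: spanM; rewrite ?span_gen //;
    by [apply: spanV|apply: spanV; apply: span_gen|apply: span_gen].
have wordP j : exists w : seq (J * bool), P j ->
    {in w, forall l, P l.1 /\ R l.1 j} /\ W j = wval y w.
  case: (pselect (P j)) => [Pj|nPj]; last by exists [::].
  by have [w Pw ew] := Wy j Pj; exists w.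
have [w {wordP}wP] := choice wordP.
pose step j (rec : forall i, R i j -> H) : H :=
  let h i := if pselect (R i j) is left r then rec i r else 1 in
  if e j then (wval h (w j))^-1 * g j else (g j)^-1 * wval h (w j).
pose h := Fix Rwf (fun=> H) step.
have hE j : P j ->
    h j = if e j then (wval h (w j))^-1 * g j else (g j)^-1 * wval h (w j).
  move=> Pj; rewrite {1}/h Fix_eq; last first.
    move=> i r r' rr'; have -> // : r = r'.
    by apply: functional_extensionality_dep => k; apply: functional_extensionality_dep.
  have [Pw _] := wP j Pj.
  rewrite /step; set h' := fun i => _; have -> // : wval h' (w j) = wval h (w j).
  by apply: eq_wval => l /Pw[_ Rl]; rewrite /h'; case: pselect.
exists h => phi phiM phiy j Pj.
have [Pw eW] := wP j Pj.
have phiW : phi (W j) = wval h (w j).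
  by rewrite eW; apply: (hom_on_wval phiM phiy) => l /Pw[].
have WP : span P y (W j) by apply: (spanS (sub j)) (Wy j Pj).
have yP : span P y (y j) by apply: span_gen.
rewrite zE // phiM //; last by case: ifP => _ //; apply: spanV.
rewrite phiW; have := phiy j Pj; rewrite hE //; case: ifP => _ ey.
  by rewrite ey mulVKg.
by rewrite (hom_onV (@span_subgroup _ _ P y) phiM) // ey invgM invgK mulVKg.
Qed.

End BasisChange.

(** * Nielsen moves and the Euclidean algorithm *)

Section BasisUpdate.
Local Open Scope group_scope.
Local Open Scope classical_set_scope.
Variables (J : choiceType) (G : groupType).
Implicit Types (P : set J) (y z : J -> G).

Lemma basis_change_update P y t W (e : bool) :
  span [set j | P j /\ j != t] y W ->
  basis_change P y
    (fun j => if j == t then W * (if e then y t else (y t)^-1) else y j).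
Proof.
move=> Wy; pose R i j := j = t /\ i != t.
have Rwf : well_founded R.
  by move=> j; constructor=> i [_ it]; constructor=> k [e1]; rewrite e1 eqxx in it.
apply: (@basis_change_triangular J G R (fun j => if j == t then W else 1)
  (fun j => if j == t then e else true) P) Rwf _ _ => j Pj.
  case: eqP => [->|_]; last exact: span1.
  by apply: spanS Wy => i [Pi it].
by case: eqP => [->|_] //; rewrite mul1g.
Qed.

Lemma basis_change_rem (D : seq J) y z t : t \in D ->
  basis_change [set j | j \in [seq j <- D | j != t]] y z ->
  basis_change [set j | j \in D] y (fun j => if j == t then y t else z j).
Proof.
move=> tD bc; apply: (@basis_change_block J G _ (fun j => j == t)) => -[].
  by apply: basis_change_eq => j [_ /eqP->]; rewrite eqxx.
have -> : [set j | [set j | j \in D] j /\ (j == t) = false] =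
          [set j | j \in [seq j <- D | j != t]].
  apply/seteqP; split=> j /=; rewrite mem_filter.
    by move=> [-> ->].
  by move=> /andP[/negbTE -> ->].
apply: basis_change_trans bc _; apply: basis_change_eq => j /=.
by rewrite mem_filter => /andP[/negbTE -> _].
Qed.

End BasisUpdate.

Section AddHom.
Local Open Scope group_scope.
Local Open Scope classical_set_scope.
Variables (J : choiceType) (G : groupType) (V : zmodType) (X : set G).
Implicit Types (P Q : set J) (z : J -> G) (f : G -> V).

Definition addhom f := forall x y, X x -> X y -> f (x * y) = (f x + f y)%R.

Hypothesis XG : subgroup X.
Variable f : G -> V.
Hypothesis fM : addhom f.

Lemma addhom1 : f 1 = 0%R.
Proof.
have := fM (subgroup1 XG) (subgroup1 XG); rewrite mulg1 => /eqP.
by rewrite -GRing.subr_eq GRing.subrr => /eqP <-.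
Qed.

Lemma addhomV x : X x -> f x^-1 = (- f x)%R.
Proof.
move=> Xx; apply/eqP; rewrite -GRing.addr_eq0 -fM ?mulVg ?addhom1 //.
exact: subgroupV.
Qed.

Lemma addhom_mulz (H : set G) x (n : int) : subgroup H -> H `<=` X -> H x ->
  exists2 u, H u & f u = (f x *~ n)%R.
Proof.
move=> HG HX Hx.
(* Negative multiples are inverses of positive ones. *)
have nat_case (m : nat) : exists2 u, H u & f u = (f x *+ m)%R.
  elim: m => [|m [u Hu e]]; first by exists 1; rewrite ?addhom1 //; apply: subgroup1.
  exists (x * u); first exact: subgroupM.
  by rewrite fM ?e ?GRing.mulrS //; apply: HX.
case: n => m; first exact: nat_case.
have [u Hu e] := nat_case m.+1; exists u^-1; first exact: subgroupV.
by rewrite addhomV ?e //; apply: HX.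
Qed.

Lemma addhom_span0 P z x : (forall j, P j -> X (z j) /\ f (z j) = 0%R) ->
  span P z x -> f x = 0%R.
Proof.
move=> z0; pose K : set G := [set x | X x /\ f x = 0%R].
suff KX : span P z `<=` K by move=> /KX[].
apply: span_min => //; apply/subgroupP; split.
- by split; [apply: subgroup1|apply: addhom1].
- move=> a b [Xa ea] [Xb eb]; split; first exact: subgroupM.
  by rewrite fM // ea eb GRing.addr0.
move=> a [Xa ea]; split; first exact: subgroupV.
by rewrite addhomV // ea GRing.oppr0.
Qed.

(** Only images in an abelian group matter below, so factors can be sorted
without any control over the words themselves. *)
Lemma span_decomp P Q z x : (forall j, P j \/ Q j -> X (z j)) ->
  span [set j | P j \/ Q j] z x ->
  exists u v, [/\ span P z u, span Q z v & f x = (f u + f v)%R].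
Proof.
move=> Xz; pose K : set G := [set x | X x /\ exists u v,
  [/\ span P z u, span Q z v & f x = (f u + f v)%R]].
have PX : span P z `<=` X by apply: span_min => // j Pj; apply: Xz; left.
have QX : span Q z `<=` X by apply: span_min => // j Pj; apply: Xz; right.
suff KX : span [set j | P j \/ Q j] z `<=` K by move=> /KX[].
apply: span_min.
  apply/subgroupP; split.
  - split; first exact: subgroup1.
    exists 1, 1; split; try exact: span1.
    by rewrite addhom1 GRing.addr0.
  - move=> a b [Xa [u [v [Pu Qv ea]]]] [Xb [u' [v' [Pu' Qv' eb]]]].
    split; first exact: subgroupM.
    exists (u * u'), (v * v'); split; try exact: spanM.
    rewrite !fM ?ea ?eb //; try by [apply: PX|apply: QX].
    by rewrite GRing.addrACA.
  move=> a [Xa [u [v [Pu Qv ea]]]]; split; first exact: subgroupV.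
  exists u^-1, v^-1; split; try exact: spanV.
  by rewrite !addhomV ?ea ?GRing.opprD //; try by [apply: PX|apply: QX].
move=> j Pj; split; first exact: Xz.
case: Pj => Pj; [exists (z j), 1|exists 1, (z j)]; split;
  rewrite ?addhom1 ?GRing.addr0 ?GRing.add0r //;
  by [exact: span1|exact: span_gen].
Qed.

Lemma span_single z t x : X (z t) -> span [set j | j = t] z x ->
  exists n : int, f x = (f (z t) *~ n)%R.
Proof.
move=> Xt; pose K : set G := [set x | X x /\ exists n : int, f x = (f (z t) *~ n)%R].
suff KX : span [set j | j = t] z `<=` K by move=> /KX[].
apply: span_min => [|_ ->]; last by split=> //; exists 1%R.
apply/subgroupP; split.
- by split; [apply: subgroup1|exists 0%R; rewrite addhom1].
- move=> a b [Xa [n ea]] [Xb [m eb]]; split; first exact: subgroupM.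
  by exists (n + m)%R; rewrite fM // ea eb mulrzDr.
move=> a [Xa [n ea]]; split; first exact: subgroupV.
by exists (- n)%R; rewrite addhomV // ea mulrNz.
Qed.

End AddHom.

Section Nielsen.
Local Open Scope group_scope.
Local Open Scope classical_set_scope.
Variables (J I : choiceType) (G : groupType) (X : set G).
Hypothesis XG : subgroup X.
Implicit Types (z : J -> G) (D : seq J).

Lemma basis_changeX D z z' : basis_change [set` D] z z' ->
  (forall j, j \in D -> X (z j)) -> forall j, j \in D -> X (z' j).
Proof.
move=> [e _] Xz j Dj; apply: (span_min XG Xz); rewrite -e.
exact: (@span_gen _ _ [set` D]).
Qed.

(** If two coordinates are nonzero, a Nielsen move decreases the larger absolute
value, hence the sum of all of them. *)
Lemma euclid (c : G -> int) D z : addhom X c -> uniq D ->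
  (forall j, j \in D -> X (z j)) -> exists2 z', basis_change [set` D] z z' &
    (forall j, j \in D -> c (z' j) = 0%R) \/
    (exists2 t, t \in D & c (z' t) != 0%R /\
       forall j, j \in D -> j != t -> c (z' j) = 0%R).
Proof.
move=> cM uD; have [n] := ubnP (\sum_(j <- D) `|c (z j)|)%N.
elim: n z => // n IH z lt_n Xz.
have [[j [k [Dj Dk jk cj ckj]]]|no] := pselect (exists j k,
  [/\ j \in D, k \in D, j != k, c (z j) != 0%R & (`|c (z j)| <= `|c (z k)|)%N]).
  pose e : bool := ((0 <= c (z j)) != (0 <= c (z k)))%R.
  (* Subtract coordinates of equal sign, add those of opposite sign. *)
  pose W := if e then z j else (z j)^-1.
  pose z1 i := if i == k then W * (if true then z k else (z k)^-1) else z i.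
  have bc1 : basis_change [set` D] z z1.
    apply: (@basis_change_update _ _ [set` D] z k W true).
    by rewrite /W; case: (e); last apply: spanV;
      apply: (@span_gen _ _ [set i | [set` D] i /\ i != k]).
  have [|z' bc' Hz'] := IH z1 _ (basis_changeX bc1 Xz); last first.
    by exists z' => //; apply: basis_change_trans bc1 bc'.
  rewrite ltnS in lt_n; apply: leq_trans lt_n.
  rewrite [X in (X < _)%N](bigD1_seq k) //= [X in (_ < X)%N](bigD1_seq k) //=.
  rewrite -addSn; apply: leq_add; last first.
    by apply: eq_leq; apply: eq_bigr => i /negbTE ik; rewrite /z1 ik.
  have Xj := Xz j Dj; have Xk := Xz k Dk.
  rewrite /z1 eqxx cM //; last by rewrite /W; case: (e) => //; apply: subgroupV.
  have -> : c W = if e then c (z j) else (- c (z j))%R.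
    by rewrite /W; case: (e) => //; apply: (addhomV XG).
  move: cj ckj; rewrite /e; move: (c (z j)) (c (z k)) => a b; clear.
  by case: (boolP (0 <= a)%R) => a0; case: (boolP (0 <= b)%R) => b0 /=; lia.
exists z; first exact: basis_change_eq.
have [[t Dt ct]|all0] := pselect (exists2 t, t \in D & c (z t) != 0%R); [right|left].
  exists t => //; split=> // j Dj jt; apply/eqP; apply: contra_notT no => cj.
  have [le|/ltnW le] := leqP `|c (z j)| `|c (z t)|; first by exists j, t.
  by exists t, j; split; rewrite // eq_sym.
by move=> j Dj; apply/eqP; apply: contra_notT all0 => cj; exists j.
Qed.

Variable f : G -> {freeg I}.
Hypothesis fM : addhom X f.

Let cM i : addhom X (fun x => coeff i (f x)).
Proof. by move=> x y Xx Xy; rewrite fM // coeffD. Qed.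

Let D_split D t : t \in D ->
  [set` D] = [set j | j = t \/ [set` [seq j <- D | j != t]] j].
Proof.
move=> Dt; apply/seteqP; split=> j /=; rewrite mem_filter.
  by have [->|_ ->] := eqVneq j t; [left|right].
by case=> [->|/andP[]].
Qed.

(** Clear the coordinates one after the other by [euclid], setting aside each time
the single generator whose coordinate survives. The generators set aside are
in echelon form, which is the independence expressed by the last clause. *)
Lemma nielsen_echelon (E : seq I) D z : uniq D ->
  (forall j, j \in D -> X (z j)) ->
  exists z' (T : seq J), [/\ basis_change [set` D] z z', {subset T <= D},
    forall j, j \in D -> j \notin T -> forall i, i \in E -> coeff i (f (z' j)) = 0%R &
    forall x, span [set` T] z' x -> (forall i, i \in E -> coeff i (f x) = 0%R) ->
      f x = 0%R].
Proof.
elim: E D z => [|i E IH] D z uD Xz.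
  exists z, [::]; split=> //; first exact: basis_change_eq.
  move=> x [[|l w] Tw ->] _; first by rewrite wval_nil (addhom1 XG fM).
  by have := Tw l (mem_head _ _).
have [z1 bc1 [c0|[t Dt [ct c0]]]] := euclid (cM i) uD Xz.
  have Xz1 := basis_changeX bc1 Xz.
  have [z' [T [bc TD KE TE]]] := IH D z1 uD Xz1.
  exists z', T; split=> //.
  - exact: basis_change_trans bc1 bc.
  - move=> j Dj jT k; rewrite inE => /orP[/eqP->|]; last exact: KE.
    apply: (addhom_span0 XG (cM i) (P := [set` D]) (z := z1)).
      by move=> k' Dk'; split; [apply: Xz1|apply: c0].
    by rewrite -bc.1; apply: (@span_gen _ _ [set` D]).
  by move=> x Tx xE; apply: TE => // k Ek; apply: xE; rewrite inE Ek orbT.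
have Xz1 := basis_changeX bc1 Xz.
pose D' := [seq j <- D | j != t].
have uD' : uniq D' by apply: filter_uniq.
have D'D j : j \in D' -> j \in D by rewrite mem_filter => /andP[].
have Xz1' j : j \in D' -> X (z1 j) by move/D'D/Xz1.
have [z2 [T [bc TD KE TE]]] := IH D' z1 uD' Xz1'.
pose z' j := if j == t then z1 t else z2 j.
have bc' : basis_change [set` D] z1 z' by apply: basis_change_rem.
have D't j : j \in D' -> (j == t) = false.
  by rewrite mem_filter => /andP[/negbTE].
have X2 : span [set` D'] z2 `<=` X by rewrite bc.1; apply: span_min.
have c2 x : span [set` D'] z2 x -> coeff i (f x) = 0%R.
  rewrite bc.1; apply: (addhom_span0 XG (cM i)) => k Dk.
  by split; [apply: Xz1'|apply: c0; rewrite ?D't //; apply: D'D].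
exists z', (t :: T); split.
- exact: basis_change_trans bc1 bc'.
- by move=> j; rewrite inE => /orP[/eqP->|/TD/D'D].
- move=> j Dj; rewrite inE negb_or => /andP[jt jT] k.
  have Dj' : j \in D' by rewrite mem_filter jt.
  rewrite /z' (negbTE jt) inE => /orP[/eqP->|]; last exact: KE.
  by apply: c2; apply: (@span_gen _ _ [set` D']).
move=> x Tx xE.
have {}Tx : span [set j | j = t \/ [set` T] j] z' x.
  by apply: spanS Tx => j /=; rewrite inE => /orP[/eqP->|]; [left|right].
have X' j : j = t \/ [set` T] j -> X (z' j).
  case=> [->|/TD Dj]; first by rewrite /z' eqxx; apply: Xz1.
  by rewrite /z' D't //; apply: X2; apply: (@span_gen _ _ [set` D']).
have [u [v [Pu Qv e]]] := span_decomp XG fM X' Tx.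
have [n eu] := span_single XG fM (X' t (or_introl erefl)) Pu.
have Tv : span [set` T] z2 v.
  by rewrite (@eq_span _ _ _ z2 z') // => j /TD /D't; rewrite /z' => ->.
have D'v : span [set` D'] z2 v by apply: spanS Tv.
have n0 : n = 0%R.
  have := xE i (mem_head _ _); rewrite e eu coeffD c2 // GRing.addr0.
  rewrite raddfMz /= /z' eqxx => /eqP.
  by rewrite mulrz_eq0 (negbTE ct) orbF => /eqP.
have ex : f x = f v by rewrite e eu n0 mulr0z GRing.add0r.
rewrite ex; apply: TE => // k Ek; rewrite -ex; apply: xE.
by rewrite inE Ek orbT.
Qed.

Lemma realize_coeffs (H : set G) (E : seq I) (n : I -> int) :
  subgroup H -> H `<=` X -> uniq E ->
  (forall i, i \in E -> exists2 x, H x &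
    forall k, k \in E -> coeff k (f x) = (k == i)%:R%R) ->
  exists2 x, H x & forall k, k \in E -> coeff k (f x) = n k.
Proof.
move=> HG HX uE dual.
suff /(_ E uE)[//|x Hx xE] : forall E', uniq E' -> {subset E' <= E} ->
    exists2 x, H x & forall k, k \in E ->
      coeff k (f x) = (if k \in E' then n k else 0)%R.
  by exists x => // k Ek; rewrite xE // Ek.
elim=> [|i E' IH] uE' sE.
  by exists 1; [apply: subgroup1|move=> k _; rewrite (addhom1 XG fM) coeff0].
move: uE' => /= /andP[iE' uE'].
have Ei : i \in E by apply: sE; rewrite mem_head.
have [|x Hx xE] := IH uE'; first by move=> k kE'; apply: sE; rewrite inE kE' orbT.
have [x0 Hx0 x0E] := dual i Ei.
have [x1 Hx1 x1E] := addhom_mulz XG fM (n i) HG HX Hx0.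
exists (x * x1) => [|k Ek]; first exact: subgroupM.
rewrite fM; [|exact: HX|exact: HX].
rewrite coeffD xE // x1E raddfMz /= x0E // inE.
have [->|ki] := eqVneq k i; first by rewrite (negbTE iE') GRing.add0r intz.
by rewrite mul0rz GRing.addr0.
Qed.

(** As in [nielsen_echelon], but the existence of elements dual to the coordinates
forces the surviving coordinate to be 1 or -1, and allows the generator set
aside to be corrected by the others into a member of the dual basis. *)
Lemma nielsen_dual (E : seq I) D z (s0 : I -> J) : uniq D ->
  (forall j, j \in D -> X (z j)) -> uniq E ->
  (forall i, i \in E -> exists2 x, span [set` D] z x &
    forall k, k \in E -> coeff k (f x) = (k == i)%:R%R) ->
  exists z' (s : I -> J), [/\ basis_change [set` D] z z',
    {in E, forall i, s i \in D}, {in E &, injective s} &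
    forall j k, j \in D -> k \in E -> coeff k (f (z' j)) = (j == s k)%:R%R].
Proof.
elim: E D z => [|i E IH] D z uD Xz /=.
  by exists z, s0; split=> //; exact: basis_change_eq.
move=> /andP[iE uE] dual.
have [z1 bc1 euc] := euclid (cM i) uD Xz; have Xz1 := basis_changeX bc1 Xz.
case: euc => [c0|[t Dt [ct c0]]].
  have [x Dx xE] := dual i (mem_head _ _).
  have := xE i (mem_head _ _); rewrite eqxx.
  rewrite (addhom_span0 XG (cM i) (P := [set` D]) (z := z1)) //.
    by move=> j Dj; split; [apply: Xz1|apply: c0].
  by rewrite bc1.1.
pose D' := [seq j <- D | j != t].
have uD' : uniq D' by apply: filter_uniq.
have D'D j : j \in D' -> j \in D by rewrite mem_filter => /andP[].
have Xz1' j : j \in D' -> X (z1 j) by move/D'D/Xz1.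
have D't j : j \in D' -> (j == t) = false.
  by rewrite mem_filter => /andP[/negbTE].
have c1 x : span [set` D'] z1 x -> coeff i (f x) = 0%R.
  apply: (addhom_span0 XG (cM i)) => k Dk.
  by split; [apply: Xz1'|apply: c0; rewrite ?D't //; apply: D'D].
have split_x x : span [set` D] z x -> exists (n : int) v,
    span [set` D'] z1 v /\ f x = (f (z1 t) *~ n + f v)%R.
  rewrite -bc1.1 (D_split Dt) => Dx.
  have X' j : j = t \/ [set` D'] j -> X (z1 j) by case=> [->|/D'D]; apply: Xz1.
  have [u [v [Pu Qv e]]] := span_decomp XG fM X' Dx.
  have [n eu] := span_single XG fM (Xz1 t Dt) Pu.
  by exists n, v; rewrite e eu.
have d1 : (coeff i (f (z1 t)) != 1 -> coeff i (f (z1 t)) = -1)%R.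
  move=> d1; have [x Dx xE] := dual i (mem_head _ _).
  have [n [v [D'v ex]]] := split_x x Dx.
  have := xE i (mem_head _ _); rewrite eqxx ex coeffD c1 // GRing.addr0 raddfMz /=.
  rewrite mulrzz GRing.mulrC => /intUnitRing.unitzPl.
  by rewrite qualifE /= (negbTE d1) => /eqP.
have dual' k : k \in E -> exists2 x, span [set` D'] z1 x &
    forall l, l \in E -> coeff l (f x) = (l == k)%:R%R.
  move=> Ek; have Ek' : k \in i :: E by rewrite inE Ek orbT.
  have [x Dx xE] := dual k Ek'.
  have [n [v [D'v ex]]] := split_x x Dx; exists v => // l El.
  have ik : (i == k) = false by apply: contraNF iE => /eqP->.
  have n0 : n = 0%R.
    have := xE i (mem_head _ _); rewrite ik ex coeffD c1 // GRing.addr0 raddfMz /=.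
    by move/eqP; rewrite mulrz_eq0 (negbTE ct) orbF => /eqP.
  by rewrite -xE ?ex ?n0 ?mulr0z ?GRing.add0r // inE El orbT.
have [z2 [s [bc2 sD' s_inj sE]]] := IH D' z1 uD' Xz1' uE dual'.
have X2 : span [set` D'] z2 `<=` X by rewrite bc2.1; apply: span_min.
pose e := coeff i (f (z1 t)) == 1%R.
pose zt := if e then z1 t else (z1 t)^-1.
have Xt : X (z1 t) by apply: Xz1.
have Xzt : X zt by rewrite /zt; case: ifP => // _; apply: subgroupV.
have [W D'W WE] : exists2 x, span [set` D'] z2 x &
    forall k, k \in E -> coeff k (f x) = (- coeff k (f zt))%R.
  apply: realize_coeffs => //; first exact: span_subgroup.
  move=> k Ek; exists (z2 (s k)); first by apply: (@span_gen _ _ [set` D']); apply: sD'.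
  move=> l El; rewrite sE //; last exact: sD'.
  by rewrite (inj_in_eq s_inj) // eq_sym.
pose z3 j := if j == t then z1 t else z2 j.
have bc3 : basis_change [set` D] z1 z3 by apply: basis_change_rem.
pose z' j := if j == t then W * (if e then z3 t else (z3 t)^-1) else z3 j.
have bc' : basis_change [set` D] z3 z'.
  apply: (@basis_change_update _ _ [set` D] z3 t W e).
  rewrite (@eq_span _ _ _ z3 z2); last by move=> j [_ /negbTE]; rewrite /z3 => ->.
  by apply: spanS D'W => j /=; rewrite mem_filter => /andP[-> ->].
have z't : z' t = W * zt by rewrite /z' /z3 eqxx.
have z'j j : (j == t) = false -> z' j = z2 j by rewrite /z' /z3 => ->.
pose s' k := if k == i then t else s k.
have s'E k : k \in E -> s' k = s k.
  by move=> Ek; rewrite /s'; case: eqP => // ki; rewrite -ki Ek in iE.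
exists z', s'; split.
- exact: basis_change_trans (basis_change_trans bc1 bc3) bc'.
- move=> k; rewrite inE => /orP[/eqP->|Ek]; first by rewrite /s' eqxx.
  by rewrite s'E //; apply/D'D/sD'.
- move=> k l; rewrite !inE => /orP[/eqP->|Ek] /orP[/eqP->|El] //.
  + by rewrite /s' eqxx -/(s' l) s'E // => et; have := D't _ (sD' _ El); rewrite -et eqxx.
  + by rewrite /s' eqxx -/(s' k) s'E // => et; have := D't _ (sD' _ Ek); rewrite et eqxx.
  by rewrite !s'E //; apply: s_inj.
move=> j k Dj; have [->|/negbTE jt] := eqVneq j t.
  rewrite z't fM ?coeffD; [|exact: X2|by []].
  rewrite inE => /orP[/eqP->|Ek].
    rewrite /s' !eqxx c1 -?bc2.1 // GRing.add0r /zt.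
    have [//|/negbTE e1] := boolP e; first by move/eqP.
    by rewrite (addhomV XG fM) // coeffN d1 // -/e e1.
  rewrite WE // GRing.addNr s'E //.
  by rewrite eq_sym D't // sD'.
have D'j : j \in D' by rewrite mem_filter jt.
rewrite z'j // inE => /orP[/eqP->|Ek]; last by rewrite s'E // sE.
by rewrite /s' eqxx jt c1 // -bc2.1; apply: (@span_gen _ _ [set` D']).
Qed.

End Nielsen.

(** * A basis adapted to a surjection onto a free abelian group *)

Section WellOrder.
Variable T : choiceType.

Lemma exists_well_order : exists le : rel T,
  [/\ reflexive le, antisymmetric le, transitive le, total le &
      well_founded (fun x y => le x y && (x != y))].
Proof.
have [le le_wo] := well_ordering_principle T.
have le_ch : wo_chain le predT by move=> A _; apply: le_wo.
have leT x y : le x y || le y x by apply: (wo_chainW le_ch).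
have leA x y : le x y -> le y x -> x = y.
  by move=> xy yx; apply: (wo_chain_antisymmetric le_ch) => //; rewrite xy.
exists le; split.
- by move=> x; have := leT x x; rewrite orbb.
- by move=> x y /andP[]; apply: leA.
- move=> y x z xy yz.
  have [|m [[/= mxyz mle] _]] := le_wo [pred t | t \in [:: x; y; z]].
    by exists x; rewrite !inE eqxx.
  move: mxyz; rewrite !inE => /or3P[] /eqP em; subst m.
  + by apply: mle; rewrite !inE eqxx !orbT.
  + have e : x = y by apply: leA xy _; apply: mle; rewrite !inE eqxx.
    by rewrite e.
  + have e : y = z by apply: leA yz _; apply: mle; rewrite !inE eqxx !orbT.
    by rewrite -e.
- exact: leT.
move=> x; apply: contrapT => nx.
have [|m [[/asboolP nm mle] _]] := le_wo
    [pred t | `[< ~ Acc (fun x y => le x y && (x != y)) t >]].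
  by exists x; apply/asboolP.
apply: nm; constructor=> t /andP[tm ne]; apply: contrapT => nt.
by move/eqP: ne; apply; apply: leA tm _; apply: mle; apply/asboolP.
Qed.

Lemma well_founded_min (R : T -> T -> Prop) (A : T -> Prop) :
  well_founded R -> (exists x, A x) -> exists2 x, A x & forall y, A y -> ~ R y x.
Proof.
move=> Rwf [x Ax]; apply: contrapT => no.
elim/(well_founded_ind Rwf): x Ax => x IH Ax.
by apply: no; exists x => // y Ay Ryx; apply: IH Ryx Ay.
Qed.

End WellOrder.

Section Adapted.
Local Open Scope group_scope.
Local Open Scope classical_set_scope.
Variables (J I : choiceType) (G : groupType) (P : set J) (y : J -> G).
Variable f : G -> {freeg I}.
Let X := span P y.
Hypothesis fM : addhom X f.
Let XG : subgroup X. Proof. exact: span_subgroup. Qed.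

Section Ranked.
Variables (N : Type) (lt : N -> N -> Prop) (pred succ : N -> N).
Variables (rJ : J -> N) (rI : I -> N) (s0 : I -> J).
Let le a b := lt a b \/ a = b.
Hypothesis lt_wf : well_founded lt.
Hypothesis lt_trans : forall a b c, lt a b -> lt b c -> lt a c.
Hypothesis lt_total : forall a b, [\/ lt a b, a = b | lt b a].
Hypothesis lt_succ : forall a, lt a (succ a).
Hypothesis le_pred : forall a b, lt a b -> le a (pred b).
Hypothesis pred_le : forall a b, le a (succ b) -> le (pred a) b.
Hypothesis le_succ : forall a b, le a (succ b) -> a = succ b \/ le a b.
Hypothesis dom_rank : forall j i, P j -> lt (rJ j) (rI i) -> coeff i (f (y j)) = 0%R.
Hypothesis lift_rank : forall i, exists2 x,
  span [set j | P j /\ le (rJ j) (succ (rI i))] y x & f x = << i >>.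
Hypothesis finJ : forall a, exists D : seq J,
  forall j, P j -> rJ j = a \/ pred (rJ j) = a -> j \in D.
Hypothesis finI : forall a, exists E : seq I, forall i, rI i = a -> i \in E.

Let lt_irr a : ~ lt a a.
Proof. by elim/(well_founded_ind lt_wf): a => a IH aa; apply: (IH a). Qed.

Let coeffM i : addhom X (fun x => coeff i (f x)).
Proof. by move=> u v Xu Xv; rewrite fM // coeffD. Qed.

Let coeff_span0 i (Q : set J) (z : J -> G) x :
  (forall j, Q j -> X (z j) /\ coeff i (f (z j)) = 0%R) ->
  span Q z x -> coeff i (f x) = 0%R.
Proof. exact: (addhom_span0 XG (coeffM i)). Qed.

Let level_seq (r : J -> N) a : (exists D : seq J, forall j, P j -> r j = a -> j \in D) ->
  exists D : seq J, uniq D /\ forall j, j \in D <-> P j /\ r j = a.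
Proof.
move=> [D DP]; exists [seq j <- undup D | `[< P j /\ r j = a >]].
split=> [|j]; first by rewrite filter_uniq ?undup_uniq.
rewrite mem_filter mem_undup; split=> [/andP[/asboolP]//|[Pj rj]].
by rewrite DP // andbT; apply/asboolP.
Qed.

Let levelJ : exists D : N -> seq J, forall a,
  uniq (D a) /\ forall j, j \in D a <-> P j /\ rJ j = a.
Proof.
have /choice[D DP] : forall a, exists D : seq J,
    uniq D /\ forall j, j \in D <-> P j /\ rJ j = a.
  move=> a; apply: level_seq; have [D DP] := finJ a.
  by exists D => j Pj rj; apply: DP => //; left.
by exists D.
Qed.

Let levelI : exists E : N -> seq I, forall a,
  uniq (E a) /\ forall i, i \in E a <-> rI i = a.
Proof.
have /choice[E EP] : forall a, exists E : seq I,
    uniq E /\ forall i, i \in E <-> rI i = a.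
  move=> a; have [E EP] := finI a; exists [seq i <- undup E | `[< rI i = a >]].
  split=> [|i]; first by rewrite filter_uniq ?undup_uniq.
  rewrite mem_filter mem_undup; split=> [/andP[/asboolP]//|ri].
  by rewrite EP // andbT; apply/asboolP.
by exists E.
Qed.

Let Xy j : P j -> X (y j). Proof. exact: span_gen. Qed.

(** The set [T] collects, over all ranks r, the generators T_r whose images are
independent modulo lower ranks; its complement in [P] collects the K_r, whose
images have rank below r. *)
Let round1 : exists (z : J -> G) (T : set J), [/\ basis_change P y z,
  forall j i, P j -> lt (rJ j) (rI i) -> coeff i (f (z j)) = 0%R,
  forall j i, P j -> ~ T j -> rI i = rJ j -> coeff i (f (z j)) = 0%R,
  forall Q, span [set j | P j /\ Q (rJ j)] y = span [set j | P j /\ Q (rJ j)] z &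
  forall a x, span [set j | [/\ P j, T j & rJ j = a]] z x ->
    (forall i, rI i = a -> coeff i (f x) = 0%R) -> f x = 0%R].
Proof.
have [D DP] := levelJ; have [E EP] := levelI.
have D_set a : [set j | j \in D a] = [set j | P j /\ rJ j = a].
  by apply/seteqP; split=> j /(DP a).2.
have /choice[zT zTP] : forall a, exists zT : (J -> G) * seq J,
  [/\ basis_change [set j | j \in D a] y zT.1, {subset zT.2 <= D a},
    forall j, j \in D a -> j \notin zT.2 ->
      forall i, i \in E a -> coeff i (f (zT.1 j)) = 0%R &
    forall x, span [set j | j \in zT.2] zT.1 x ->
      (forall i, i \in E a -> coeff i (f x) = 0%R) -> f x = 0%R].
  move=> a; have [|z [T zT]] := nielsen_echelon XG fM (E a) (z := y) (DP a).1.
    by move=> j /(DP a).2[Pj _]; apply: Xy.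
  by exists (z, T).
pose z j := (zT (rJ j)).1 j.
have zE a : basis_change [set j | P j /\ rJ j = a] y z.
  have [bc _ _ _] := zTP a; rewrite D_set in bc; apply: basis_change_trans bc _.
  by apply: basis_change_eq => j [_ <-].
have bc : basis_change P y z by apply: (basis_change_block (p := rJ)).
have zy j : P j -> span [set k | P k /\ rJ k = rJ j] y (z j).
  by move=> Pj; rewrite -(zE (rJ j)).1; apply: span_gen.
exists z, [set j | j \in (zT (rJ j)).2]; split=> //.
- move=> j i Pj ji; apply: coeff_span0 (zy j Pj) => k [Pk ek].
  by split; [apply: Xy|apply: dom_rank; rewrite ?ek].
- move=> j i Pj /negP jT ij; have [_ _ KE _] := zTP (rJ j).
  by apply: KE => //; [apply/(DP _).2|apply/(EP _).2].
- move=> Q; apply/seteqP; split; apply: span_sub => j [Pj Qj].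
    have : span [set k | P k /\ rJ k = rJ j] z (y j).
      by rewrite (zE (rJ j)).1; apply: span_gen.
    by apply: spanS => k [Pk ek]; rewrite /= ek.
  by apply: spanS (zy j Pj) => k [Pk ek]; rewrite /= ek.
move=> a x xT xE; have [_ TD _ TE] := zTP a.
apply: TE; last by move=> i /(EP a).2; apply: xE.
rewrite (@eq_span _ _ _ _ z); last by move=> j /TD/(DP a).2[_ <-].
by apply: spanS xT => j [Pj /= + ej]; rewrite ej.
Qed.

(** The function [q] gives the block of a generator: a member of T_r stays in
block r, and a member of K_r moves to block pred r, which by [le_pred] still bounds
the ranks in its image. *)
Let round2 : exists (z : J -> G) (q : J -> N) (s : I -> J), [/\ basis_change P y z,
  injective s, forall i, P (s i) /\ q (s i) = rI i,
  forall j k, P j -> rI k = q j -> coeff k (f (z j)) = (j == s k)%:R%R &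
  forall j k, P j -> lt (q j) (rI k) -> coeff k (f (z j)) = 0%R].
Proof.
have [z1 [T [bc1 z1gt z1eq z1span T0]]] := round1.
have Xz1 j : P j -> X (z1 j) by move=> Pj; rewrite /X -bc1.1; apply: span_gen.
pose q j := if `[< T j >] then rJ j else pred (rJ j).
have z1q j i : P j -> lt (q j) (rI i) -> coeff i (f (z1 j)) = 0%R.
  rewrite /q; case: asboolP => [_|nT]; first exact: z1gt.
  move=> Pj qi; have [ij|ij|ij] := lt_total (rI i) (rJ j).
  - case: (le_pred ij) => [ij'|ij']; first by case: (lt_irr (lt_trans qi ij')).
    by rewrite -ij' in qi; case: (lt_irr qi).
  - exact: z1eq.
  exact: z1gt.
have dual i : exists2 x, span [set j | P j /\ q j = rI i] z1 x &
    forall k, rI k = rI i -> coeff k (f x) = (k == i)%:R%R.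
  have [w Pw fw] := lift_rank i.
  pose A := [set j | [/\ P j, T j & rJ j = succ (rI i)]].
  pose B := [set j | P j /\ q j = rI i].
  pose C := [set j | P j /\ lt (q j) (rI i)].
  have {}Pw : span [set j | A j \/ (B j \/ C j)] z1 w.
    rewrite (z1span (fun a => le a (succ (rI i)))) in Pw; apply: spanS Pw => j [Pj le_j].
    rewrite /A /B /C /q /=; case: asboolP => [Tj|_].
      by case: (le_succ le_j) => [ej|[ltj|ej]]; [left|right; right|right; left].
    by case: (pred_le le_j) => [ltj|ej]; right; [right|left].
  have sub j : A j \/ (B j \/ C j) -> P j by case=> [[]|[[]|[]]].
  have [a [bc [Aa BCbc ew]]] := span_decomp XG fM (fun j Pj => Xz1 j (sub j Pj)) Pw.
  have sub' j : B j \/ C j -> P j by case=> -[].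
  have [b [c [Bb Cc ebc]]] := span_decomp XG fM (fun j Pj => Xz1 j (sub' j Pj)) BCbc.
  have b0 k : lt (rI i) (rI k) -> coeff k (f b) = 0%R.
    move=> ik; apply: coeff_span0 Bb => j [Pj ej].
    by split; [apply: Xz1|apply: z1q; rewrite ?ej].
  have c0 k : le (rI i) (rI k) -> coeff k (f c) = 0%R.
    move=> ik; apply: coeff_span0 Cc => j [Pj ltj]; split; first exact: Xz1.
    by apply: z1q => //; case: ik => [ik|<-] //; apply: lt_trans ik.
  (* The independent part of rank succ (rI i) cannot contribute to w. *)
  have a0 : f a = 0%R.
    apply: T0 Aa _ => k ek; have := congr1 (coeff k) ew.
    have ik : lt (rI i) (rI k) by rewrite ek.
    rewrite fw ebc !coeffD b0 // c0; last by left.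
    rewrite !GRing.addr0 => <-; rewrite coeffU GRing.mul1r.
    by case: eqP => // eik; rewrite eik in ik; case: (lt_irr ik).
  exists b => // k ek; have := congr1 (coeff k) ew.
  rewrite fw ebc a0 GRing.add0r coeffD c0 ?GRing.addr0 => [<-|]; last by right.
  by rewrite coeffU GRing.mul1r eq_sym.
have /choice[D DP] : forall a, exists D : seq J,
    uniq D /\ forall j, j \in D <-> P j /\ q j = a.
  move=> a; apply: level_seq; have [D DP] := finJ a; exists D => j Pj qj.
  by apply: DP => //; move: qj; rewrite /q; case: ifP => _; [left|right].
have [E EP] := levelI.
have D_set a : [set j | j \in D a] = [set j | P j /\ q j = a].
  by apply/seteqP; split=> j /(DP a).2.
have /choice[zs zsP] : forall a, exists zs : (J -> G) * (I -> J),
  [/\ basis_change [set j | j \in D a] z1 zs.1,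
    {in E a, forall i, zs.2 i \in D a}, {in E a &, injective zs.2} &
    forall j k, j \in D a -> k \in E a ->
      coeff k (f (zs.1 j)) = (j == zs.2 k)%:R%R].
  move=> a; have [|i|z [s zs]] := nielsen_dual XG fM (z := z1) s0 (DP a).1 _ (EP a).1.
  - by move=> j /(DP a).2[Pj _]; apply: Xz1.
  - move=> /(EP a).2 ei; have [x Dx xE] := dual i; exists x.
      by rewrite D_set -ei.
    by move=> k /(EP a).2 ek; rewrite xE // ek.
  by exists (z, s).
pose z j := (zs (q j)).1 j; pose s i := (zs (rI i)).2 i.
have zE a : basis_change [set j | P j /\ q j = a] z1 z.
  have [bc _ _ _] := zsP a; rewrite D_set in bc; apply: basis_change_trans bc _.
  by apply: basis_change_eq => j [_ <-].
have bc : basis_change P z1 z by apply: (basis_change_block (p := q)).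
have inE_ i : i \in E (rI i) by apply/(EP _).2.
have sP i : P (s i) /\ q (s i) = rI i.
  by have [_ sD _ _] := zsP (rI i); apply/(DP _).2; apply: sD.
have s_inj : injective s.
  move=> i k e; have ik : rI i = rI k by rewrite -(sP i).2 e (sP k).2.
  have [_ _ inj _] := zsP (rI i); apply: inj => //; first by rewrite ik.
  by move: e; rewrite /s ik.
exists z, q, s; split=> //; first exact: basis_change_trans bc1 bc.
- move=> j k Pj ek; have [_ _ _ zsE] := zsP (q j).
  by rewrite /z zsE /s ?ek // -?ek //; [apply/(DP _).2; rewrite ek].
move=> j k Pj lt_k; have : span [set i | P i /\ q i = q j] z1 (z j).
  by rewrite -(zE (q j)).1; apply: span_gen.
apply: coeff_span0 => i [Pi ei].
by split; [apply: Xz1|apply: z1q; rewrite ?ei].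
Qed.

(** The third change of basis. By induction on the rank every standard basis
vector is an image from blocks up to its own rank, since the error in [round2]
is of lower rank; so the errors can be removed by factors from lower
blocks. *)
Lemma adapted_of_rank : exists (z : J -> G) (s : I -> J), [/\ basis_change P y z,
  injective s, forall i, P (s i), forall i, f (z (s i)) = << i >> &
  forall j, P j -> (forall i, j != s i) -> f (z j) = 0%R].
Proof.
have [z [q [s [bc s_inj sP zeq zgt]]]] := round2.
have Xz j : P j -> X (z j) by move=> Pj; rewrite /X -bc.1; apply: span_gen.
pose Low a := [set j | P j /\ lt (q j) a].
have LowX a : span (Low a) z `<=` X by apply: span_min => // j [Pj _]; apply: Xz.
have lift a v : (forall k, lt (rI k) a ->
      exists2 x, span [set j | P j /\ le (q j) (rI k)] z x & f x = << k >>) ->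
    (forall k, coeff k v != 0%R -> lt (rI k) a) ->
    exists2 x, span (Low a) z x & f x = v.
  move=> IH va; rewrite -(freeg_sumE v).
  have : forall k, k \in dom v -> lt (rI k) a by move=> k; rewrite mem_dom; apply: va.
  elim: (dom v) => [|k r IHr] ra.
    by exists 1; [apply: span1|rewrite big_nil (addhom1 XG fM)].
  have [|x Lx ex] := IHr; first by move=> l lr; apply: ra; rewrite inE lr orbT.
  have lt_k := ra k (mem_head _ _).
  have [u Lu eu] := IH k lt_k.
  have {}Lu : span (Low a) z u.
    apply: spanS Lu => j [Pj [lt_j|e]]; split=> //; last by rewrite e.
    exact: lt_trans lt_k.
  have [u' Lu' eu'] :=
    addhom_mulz XG fM (coeff k v) (@span_subgroup _ _ _ _) (@LowX a) Lu.
  exists (u' * x); first exact: spanM.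
  rewrite fM; [|exact: (LowX a)|exact: (LowX a)].
  by rewrite big_cons ex eu' eu freegU_mulz intz.
have hit i : exists2 x, span [set j | P j /\ le (q j) (rI i)] z x & f x = << i >>.
  have [a] : exists a, a = rI i by exists (rI i).
  elim/(well_founded_ind lt_wf): a i => a IH i ea.
  have [Ps qs] := sP i.
  have [||x Lx ex] := lift a (<< i >> - f (z (s i)))%R.
  - by move=> k lt_k; apply: IH lt_k _ _.
  - move=> k; have [//|ek|lt_k] := lt_total (rI k) a.
      rewrite coeffB coeffU zeq ?qs -?ea // (inj_eq s_inj) GRing.mul1r GRing.subrr.
      by rewrite eqxx.
    rewrite coeffB coeffU zgt ?qs -?ea // GRing.subr0 GRing.mul1r.
    case: (i =P k) => [eik|_] //.
    by rewrite -eik -ea in lt_k; case: (lt_irr lt_k).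
  exists (x * z (s i)).
    apply: spanM; first by apply: spanS Lx => j [Pj lt_j]; split=> //; left; rewrite -ea.
    by apply: span_gen; split=> //; right.
  rewrite fM; [|exact: (LowX a)|exact: Xz].
  by rewrite ex GRing.subrK.
have target j : exists v : {freeg I}, (forall i, j = s i -> v = << i >>) /\
    ((forall i, j != s i) -> v = 0%R).
  have [[i ->]|no] := pselect (exists i, j = s i).
    by exists << i >>; split=> [k /s_inj->|/(_ i)]; rewrite ?eqxx.
  by exists 0%R; split=> // i e; case: no; exists i.
have [v vP] := choice target.
have Wex j : exists W : G, P j -> span (Low (q j)) z W /\ f (W * z j) = v j.
  have [Pj|nP] := pselect (P j); last by exists 1.
  have [||x Lx ex] := lift (q j) (v j - f (z j))%R.
  - by move=> k _; apply: hit.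
  - move=> k; have [//|ek|lt_k] := lt_total (rI k) (q j).
      rewrite coeffB zeq //; have [ej|ne] := eqVneq j (s k).
        by rewrite ((vP j).1 k) // coeffU eqxx GRing.subrr eqxx.
      have [[i ei]|no] := pselect (exists i, j = s i).
        rewrite ((vP j).1 i) // coeffU GRing.subr0 GRing.mul1r.
        by case: (i =P k) => [eik|_] //; rewrite ei eik eqxx in ne.
      rewrite (vP j).2 ?coeff0 ?GRing.subr0 ?eqxx // => i.
      by apply/eqP => ei; case: no; exists i.
    rewrite coeffB zgt // GRing.subr0.
    have [[i ei]|no] := pselect (exists i, j = s i).
      rewrite ((vP j).1 i) // coeffU GRing.mul1r.
      case: (i =P k) => [eik|_] //.
      by rewrite ei (sP i).2 eik in lt_k; case: (lt_irr lt_k).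
    rewrite (vP j).2 ?coeff0 ?eqxx // => i.
    by apply/eqP => ei; case: no; exists i.
  exists x => _; split=> //; rewrite fM; [|exact: (LowX (q j))|exact: Xz].
  by rewrite ex GRing.subrK.
have [W WP] := choice Wex.
exists (fun j => W j * z j), s; split=> //.
- apply: basis_change_trans bc _.
  apply: (@basis_change_triangular _ _ (fun i j => lt (q i) (q j)) W (fun=> true)).
  - exact: (wf_inverse_image _ _ lt q lt_wf).
  - by move=> j /WP[].
  by [].
- by move=> i; case: (sP i).
- by move=> i; have [Ps _] := sP i; rewrite (WP _ Ps).2 ((vP _).1 i).
by move=> j Pj js; rewrite (WP _ Pj).2 (vP j).2.
Qed.
End Ranked.

(** The lists [SS a n] are the n-th stages of the closure of the generator a. The
rank of a generator or of an index is the lexicographically least pair (a, n)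
for which it occurs in the n-th stage started at a, for a well-order on the
generators; levels are finite because each stage is a finite list. *)
Theorem adapted_basis (j0 : J) : (forall v, exists2 x, X x & f x = v) ->
  exists (z : J -> G) (s : I -> J), [/\ basis_change P y z,
    injective s, forall i, P (s i), forall i, f (z (s i)) = << i >> &
    forall j, P j -> (forall i, j != s i) -> f (z j) = 0%R].
Proof.
move=> fonto; have [leJ [leJJ leJA leJT leJtot leJwf]] := exists_well_order J.
pose ltJ a b := leJ a b && (a != b).
pose lt (a b : J * nat) := ltJ a.1 b.1 \/ a.1 = b.1 /\ (a.2 < b.2)%N.
have ltJT a b c : ltJ a b -> ltJ b c -> ltJ a c.
  move=> /andP[ab nab] /andP[bc nbc]; rewrite /ltJ (leJT _ _ _ ab bc) /=.
  by apply: contraNneq nab => eac; rewrite -eac in bc; apply/eqP/leJA; rewrite ab.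
have lt_wf : well_founded lt.
  move=> [a n]; elim/(well_founded_ind leJwf): a n => a IHa n.
  have [m] := ubnP n; elim: m n => [n|m IHm n lt_n]; first by rewrite ltn0.
  constructor=> -[b k] [/= ba|/= [-> kn]]; first exact: IHa.
  by apply: IHm; apply: leq_trans kn _.
have lt_trans a b c : lt a b -> lt b c -> lt a c.
  case: a b c => [a n] [b m] [c k]; rewrite /lt /=.
  move=> [ab|[-> nm]] [bc|[<- mk]]; try by left.
    by left; apply: ltJT bc.
  by right; split=> //; apply: ltn_trans mk.
have lt_total a b : [\/ lt a b, a = b | lt b a].
  case: a b => [a n] [b m]; rewrite /lt /ltJ /=.
  have [->|ab] := eqVneq a b.
    have [nm|nm|->] := ltngtP n m; [constructor 1|constructor 3|constructor 2];
      by try right.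
  have /orP[le_ab|le_ba] := leJtot a b; [constructor 1|constructor 3]; left;
    by rewrite ?le_ab ?le_ba // eq_sym.
pose succ (a : J * nat) := (a.1, a.2.+1); pose pred (a : J * nat) := (a.1, a.2.-1).
have lt_succ a : lt a (succ a) by right.
have le_pred a b : lt a b -> lt a (pred b) \/ a = pred b.
  case: a b => [a n] [b [|m]] [/= ab|/= [-> nm]] //; try by left; left.
  rewrite /pred /=; move: nm; rewrite ltnS leq_eqVlt => /orP[/eqP->|nm]; first by right.
  by left; right.
have le_succ a b : lt a (succ b) \/ a = succ b -> a = succ b \/ (lt a b \/ a = b).
  move=> [|->]; last by left.
  by move=> /le_pred; case: b => b m; right.
have pred_le a b : lt a (succ b) \/ a = succ b -> lt (pred a) b \/ pred a = b.
  move/le_succ => [->|ab]; first by case: b => b m; right.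
  have [lt_p|-> //] : lt (pred a) a \/ pred a = a.
    by case: (a) => c [|n]; [right|left; right].
  by left; case: ab => [ab|<-] //; apply: lt_trans ab.
have /choice[x xP] : forall i, exists x, X x /\ f x = << i >>.
  by move=> i; have [x Xx fx] := fonto << i >>; exists x.
have /choice[w wP] : forall i, exists w : seq (J * bool),
    {in w, forall l, P l.1} /\ x i = wval y w.
  by move=> i; have [[w Pw e] _] := xP i; exists w.
pose next (E : seq I) := flatten [seq [seq l.1 | l <- w i] | i <- E].
pose supp (S : seq J) := flatten [seq dom (f (y j)) | j <- S].
pose fix SS a n : seq J := if n is n'.+1 then next (supp (SS a n')) else [:: a].
pose EE a n := supp (SS a n).
have rJex j : exists a, j \in SS a.1 a.2 /\ forall b, j \in SS b.1 b.2 -> ~ lt b a.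
  have [|a ja min] := @well_founded_min _ lt (fun a => j \in SS a.1 a.2) lt_wf.
    by exists (j, 0%N); rewrite /= inE.
  by exists a.
have [rJ rJP] := choice rJex.
have rIex i : exists a, i \in EE a.1 a.2 /\ forall b, i \in EE b.1 b.2 -> ~ lt b a.
  have [|a ia min] := @well_founded_min _ lt (fun a => i \in EE a.1 a.2) lt_wf.
    apply: contrapT => no; have [Xx fx] := xP i.
    suff : coeff i (f (x i)) = 0%R by rewrite fx coeffU eqxx.
    apply: (addhom_span0 XG (f := fun x => coeff i (f x)) _ _ Xx).
      by move=> u v Xu Xv; rewrite fM // coeffD.
    move=> j Pj; split; first exact: span_gen.
    apply: coeff_outdom; apply/negP => ij; case: no; exists (j, 0%N).
    by rewrite /EE /= /supp /= cats0.
  by exists a.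
have [rI rIP] := choice rIex.
apply: (@adapted_of_rank (J * nat)%type lt pred succ rJ rI (fun=> j0) lt_wf
  lt_trans lt_total lt_succ le_pred pred_le le_succ).
- move=> j i Pj ji; apply: coeff_outdom; apply/negP => ij.
  have [jS _] := rJP j; have [_ /(_ (rJ j))] := rIP i; apply=> //.
  by apply/flattenP; exists (dom (f (y j))) => //; apply: map_f.
- move=> i; have [[Xx fx] [Pw ew]] := (xP i, wP i); exists (x i) => //.
  exists (w i) => // l lw; split; first exact: Pw.
  have [iE _] := rIP i; have [_ /(_ (succ (rI i)))] := rJP l.1.
  case: (lt_total (rJ l.1) (succ (rI i))) => [|->|]; [by left|by right|].
  move=> lt_l; case=> //; apply/flattenP; exists [seq l.1 | l <- w i].
    exact: map_f.
  exact: map_f.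
- move=> a; exists (SS a.1 a.2 ++ SS a.1 a.2.+1) => j _; have [jS _] := rJP j.
  rewrite mem_cat => -[<-|ea]; first by rewrite jS.
  move: jS; rewrite -ea /pred; case: (rJ j) => b [|n] /= jS; first by rewrite jS.
  by apply/orP; right.
by move=> a; exists (EE a.1 a.2) => i <-; have [] := rIP i.
Qed.
End Adapted.

(** * Signed sorted words and finitely supported vectors *)

Section SignedLetters.
Local Open Scope ring_scope.
Variables (I : choiceType) (leI : rel I).
Hypotheses (leI_refl : reflexive leI) (leI_anti : antisymmetric leI).
Hypotheses (leI_trans : transitive leI) (leI_total : total leI).
Implicit Types (l : I * bool) (ls : seq (I * bool)) (v : {freeg I}).

(** Index coherence for letters in [I]. *)
Definition coherent ls := {in ls &, forall l l', l.1 = l'.1 -> l.2 = l'.2}.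

Definition le_letter : rel (I * bool) := relpre fst leI.

Definition lvec l : {freeg I} := << (if l.2 then 1 else -1) *g l.1 >>.

Definition svec ls : {freeg I} := \sum_(l <- ls) lvec l.

Lemma svec_cons l ls : svec (l :: ls) = lvec l + svec ls.
Proof. exact: big_cons. Qed.

Lemma svec_rcons l ls : svec (rcons ls l) = svec ls + lvec l.
Proof. by rewrite /svec big_rcons /= GRing.addrC. Qed.

Lemma coeff_lvec k l :
  coeff k (lvec l) = if l.1 == k then if l.2 then 1 else -1 else 0.
Proof. by rewrite coeffU; case: (l.1 == k); rewrite ?GRing.mulr1 ?GRing.mulr0. Qed.

Lemma coeff_svec k ls : coeff k (svec ls) =
  (count_mem (k, true) ls)%:Z - (count_mem (k, false) ls)%:Z.
Proof.
elim: ls => [|[j e] ls IH]; first by rewrite /svec big_nil coeff0.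
rewrite svec_cons coeffD IH coeff_lvec /= !xpair_eqE.
by case: eqP => _; case: e; rewrite /=; lia.
Qed.

Lemma count_coherent k ls : coherent ls ->
  (count_mem (k, true) ls == 0)%N || (count_mem (k, false) ls == 0)%N.
Proof.
move=> coh; apply: contraT; rewrite negb_or -!lt0n -!has_count !has_pred1.
by move=> /andP[kt kf]; have := coh _ _ kt kf erefl.
Qed.

(** In a coherent word the two signs of an index do not both occur, so the
multiplicities can be read off the sum. *)
Lemma coherent_count l ls : coherent ls -> count_mem l ls =
  if l.2 == (0 <= coeff l.1 (svec ls)) then `|coeff l.1 (svec ls)|%N else 0%N.
Proof.
move=> coh; case: l => k e; rewrite coeff_svec /=.
have := count_coherent k coh.
case: e; move: (count_mem (k, true) ls) (count_mem (k, false) ls) => m n;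
  by case: (boolP (0 <= m%:Z - n%:Z)) => mn /=; lia.
Qed.

(** The sorted coherent word with sum v: k or its inverse repeated as many times as the
coefficient of v at k says. *)
Definition code v : seq (I * bool) := sort le_letter
  (flatten [seq nseq `|coeff k v|%N (k, 0 <= coeff k v) | k <- dom v]).

Lemma mem_code v l : l \in code v -> l.1 \in dom v /\ l.2 = (0 <= coeff l.1 v).
Proof.
rewrite mem_sort => /flattenP[s /mapP[k kv ->]]; rewrite mem_nseq.
by case/andP=> _ /eqP->.
Qed.

Lemma code_coherent v : coherent (code v).
Proof. by move=> l l' /mem_code[_ ->] /mem_code[_ ->] ->. Qed.

Lemma code_sorted v : sorted le_letter (code v).
Proof. by apply: sort_sorted => l l'; apply: leI_total. Qed.

Lemma svec_code v : svec (code v) = v.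
Proof.
rewrite /svec (perm_big _ (permEl (perm_sort _ _))) /= big_flatten big_map.
rewrite -[RHS]freeg_sumE; apply: eq_bigr => k _.
rewrite big_nseq -Monoid.iteropE /= /lvec /=.
have -> : iterop `|coeff k v|%N +%R << (if 0 <= coeff k v then 1 else -1) *g k >> 0 =
  << (if 0 <= coeff k v then 1 else -1) *g k >> *+ `|coeff k v|%N :> {freeg I} by [].
rewrite freeg_muln; congr Freeg; congr [:: (_, _)].
by case: ifP; lia.
Qed.

(** By [coherent_count] a coherent word is determined by its sum up to order. *)
Lemma code_uniq ls : sorted le_letter ls -> coherent ls -> code (svec ls) = ls.
Proof.
move=> ls_sorted coh; have ccoh := @code_coherent (svec ls).
have ceq : perm_eq (code (svec ls)) ls.
  apply/allP => l _ /=; rewrite !coherent_count //.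
  by rewrite svec_code.
apply: (sorted_eq_in _ _ (code_sorted _) ls_sorted ceq).
  by move=> y x z _ _ _; apply: leI_trans.
move=> l l' lc l'c /leI_anti e; have := ccoh l l' lc l'c e.
by case: l l' e {lc l'c} => [k b] [k' b'] /= -> ->.
Qed.

Lemma mem_code_dom v k : k \in dom v -> (k, 0 <= coeff k v) \in code v.
Proof.
rewrite mem_dom => ck; rewrite -has_pred1 has_count.
rewrite (coherent_count _ (@code_coherent v)) /= svec_code eqxx.
by rewrite absz_gt0.
Qed.

Lemma dom_svec ls l : coherent ls -> l \in ls -> l.1 \in dom (svec ls).
Proof.
move=> coh lls; have := coherent_count l coh; rewrite mem_dom.
have : (0 < count_mem l ls)%N by rewrite -has_count has_pred1.
by move=> + e; rewrite e; case: ifP => // _; rewrite absz_gt0.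
Qed.

Definition above i v := forall k, k \in dom v -> leI i k.

Lemma aboveD i l v : leI i l.1 -> above i v -> above i (v + lvec l).
Proof.
move=> il iv k; rewrite mem_dom coeffD coeff_lvec.
case: (l.1 =P k) => [<-//|_]; rewrite GRing.addr0 -mem_dom; exact: iv.
Qed.

Lemma lvec_flip l : lvec (flip l) = - lvec l.
Proof. by rewrite /lvec freegUN; case: l => k [] /=; rewrite ?GRing.opprK. Qed.

Lemma aboveB i l v : leI i l.1 -> above i v -> above i (v - lvec l).
Proof. by move=> il iv; rewrite -lvec_flip; apply: aboveD. Qed.

Lemma above0 i : above i 0. Proof. by move=> k; rewrite dom0. Qed.

Lemma code_step l v : above l.1 v ->
  {in code v, forall l', l'.1 = l.1 -> l'.2 = l.2} ->
  code (v + lvec l) = l :: code v.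
Proof.
move=> lv lcoh; rewrite -{1}(svec_code v) GRing.addrC -svec_cons code_uniq //.
  have := code_sorted v; case E: (code v) => [|l' ls] //= ->; rewrite andbT.
  by apply: lv; have [] : l'.1 \in dom v /\ l'.2 = (0 <= coeff l'.1 v)
    by apply: mem_code; rewrite E mem_head.
move=> l1 l2; rewrite !inE => /orP[/eqP->|l1v] /orP[/eqP->|l2v] //.
- by move=> e; rewrite lcoh.
- by move=> e; rewrite lcoh.
exact: code_coherent l1v l2v.
Qed.

Lemma code0 : code 0 = [::]. Proof. by rewrite /code dom0. Qed.

(** Adding an index i that is at most every index in the support of v puts a letter
in front of the code or cancels its first letter, according to the sign of the
coefficient of v at i. *)
Lemma code_add i v : above i v ->
  code (v + << i >>) = (i, true) :: code v \/
  code v = (i, false) :: code (v + << i >>).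
Proof.
move=> iv; have [ci|ci] := boolP (0 <= coeff i v); [left|right].
  have -> : << i >> = lvec (i, true) by [].
  by apply: code_step => // l /mem_code[_ ->] ->.
have iv' : above i (v + << i >>) by apply: (@aboveD i (i, true)).
have ev : v = v + << i >> + lvec (i, false).
  by rewrite -GRing.addrA /lvec /= freegUD GRing.addrN freegU0 GRing.addr0.
rewrite {1}ev; apply: code_step => // l /mem_code[ld ->] el /=.
move: ld; rewrite el mem_dom coeffD coeffU eqxx; move: ci.
by move: (coeff i v) => c; lia.
Qed.

End SignedLetters.

(** * From the Schreier basis to the U-construction *)

Lemma ltn_well_founded : well_founded (fun m n : nat => (m < n)%N).
Proof.
move=> n; have [m] := ubnP n; elim: m n => [n|m IH n lt_n]; first by rewrite ltn0.
by constructor=> k lt_k; apply: IH; apply: leq_trans lt_k _.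
Qed.

Section UBasis.
Local Open Scope group_scope.
Local Open Scope classical_set_scope.
Variables (G : groupType) (I : choiceType) (S X : set G).
Variables (f : G -> {freeg I}) (a : I -> G) (leI : rel I).
Hypotheses (XG : subgroup X) (SB : free_basis S X) (fM : addhom X f).
Hypotheses (aS : forall i, S (a i)) (a_inj : injective a).
Hypothesis fa : forall i, f (a i) = << i >>.
Hypothesis fB : forall s, S s -> (forall i, s <> a i) -> f s = 0%R.
Hypotheses (leI_refl : reflexive leI) (leI_anti : antisymmetric leI).
Hypotheses (leI_trans : transitive leI) (leI_total : total leI).
Implicit Types (l : I * bool) (ls : seq (I * bool)) (v w : {freeg I}) (s : G) (b : bool).

Local Notation above := (above leI).
Local Notation code := (code leI).
Local Notation le_letter := (le_letter leI).

Definition kernel : set G := [set x | X x /\ f x = 0%R].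

Let S_X s : S s -> X s.
Proof. by rewrite -(span_basis XG SB); apply: (@span_gen _ _ S id). Qed.

Let aX i : X (a i). Proof. exact: S_X. Qed.

Let XV x : X x -> X x^-1. Proof. exact: subgroupV. Qed.
Let XM x y : X x -> X y -> X (x * y). Proof. exact: subgroupM. Qed.

Let kernelG : subgroup kernel.
Proof.
apply/subgroupP; split.
- by split; [apply: subgroup1|apply: addhom1 fM].
- move=> x y [Xx ex] [Xy ey]; split; first exact: XM.
  by rewrite fM // ex ey GRing.addr0.
move=> x [Xx ex]; split; first exact: XV.
by rewrite (addhomV XG fM) // ex GRing.oppr0.
Qed.

Let laX l : X (lval a l). Proof. by rewrite /lval; case: ifP => _ //; apply: XV. Qed.

Let f_la l : f (lval a l) = lvec l.
Proof.
rewrite /lval /lvec; case: l => i [] /=; first exact: fa.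
by rewrite (addhomV XG fM) // fa freegUN.
Qed.

(** The product of the letters of [code v] in decreasing order; smallest indices
come last, so that multiplication by a small a_i on the right stays inside the
transversal. *)
Definition transv v : G := wval a (rev (code v)).

Lemma transvX v : X (transv v).
Proof.
rewrite /transv; elim: (rev _) => [|l ls IH]; first by rewrite wval_nil; apply: subgroup1.
by rewrite wval_cons; apply: XM.
Qed.

Lemma f_transv v : f (transv v) = v.
Proof.
rewrite -[RHS](svec_code leI) /transv; elim: (code v) => [|l ls IH].
  by rewrite wval_nil (addhom1 XG fM) /svec big_nil.
have Xw : X (wval a (rev ls)).
  elim: (rev ls) => [|k ks IHk]; first by rewrite wval_nil; apply: subgroup1.
  by rewrite wval_cons; apply: XM.
rewrite rev_cons -cats1 wval_cat wval_cons wval_nil mulg1 fM // IH f_la.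
by rewrite svec_cons GRing.addrC.
Qed.

Lemma transv0 : transv 0%R = 1.
Proof. by rewrite /transv code0 wval_nil. Qed.

Lemma transv_add i v : above i v -> transv (v + << i >>)%R = transv v * a i.
Proof.
rewrite /transv => iv.
case: (code_add leI_refl leI_anti leI_trans leI_total iv) => ->;
  rewrite rev_cons -cats1 wval_cat wval_cons wval_nil mulg1 //.
by rewrite mulgVK.
Qed.

Lemma transv_addl l v : above l.1 v -> transv (v + lvec l)%R = transv v * lval a l.
Proof.
case: l => i [] /= iv; first exact: transv_add.
rewrite /lval /=; apply: (mulIg (a i)); rewrite mulgVK -transv_add.
  by rewrite -GRing.addrA /lvec /= freegUD GRing.addNr freegU0 GRing.addr0.
exact: (@aboveD _ _ i (i, false)).
Qed.

(** The edges at which the transversal is multiplicative, by [transv_add]. *)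
Definition tree_edge v s : Prop := exists2 i, s = a i & above i v.

Definition transv_edges : set ({freeg I} * G) := schreier_edges S X f tree_edge.
Definition transv_gen : {freeg I} * G -> G := schreier_gen f transv.

Let f_transvs v s : S s -> f (transv v * s) = (v + f s)%R.
Proof. by move=> Ss; rewrite fM ?f_transv //; [apply: transvX|apply: S_X]. Qed.

Lemma transv_genE v s : S s ->
  transv_gen (v, s) = transv v * s * (transv (v + f s)%R)^-1.
Proof. by move=> Ss; rewrite /transv_gen /schreier_gen /= f_transvs. Qed.

Lemma transv_gen_tree v s : tree_edge v s -> transv_gen (v, s) = 1.
Proof.
move=> [i -> iv]; rewrite transv_genE // fa transv_add // mulgV //.
Qed.

Lemma transv_edgesP v s : transv_edges (v, s) <-> S s /\ ~ tree_edge v s.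
Proof.
split=> [[]//|[Ss nt]]; split=> //.
by exists (transv v); [apply: transvX|apply: f_transv].
Qed.

(** The tree is descended by removing the first letter of [code v]. *)
Let transv_hyps :
  [/\ kernel `<=` X,
    forall x y, X x -> X y -> f x = f y <-> kernel (x * y^-1),
    transv (f 1) = 1,
    forall x s, X x -> S s -> tree_edge (f x) s ->
      transv (f x) * s = transv (f (transv (f x) * s)) &
    forall x, X x -> transv (f x) = 1 \/
      exists x' s, [/\ X x', S s, (size (code (f x')) < size (code (f x)))%N &
      (tree_edge (f x') s /\ transv (f x) = transv (f x') * s) \/
      (tree_edge (f x) s /\ transv (f x) * s = transv (f x'))]].
Proof.
split=> [x []//|x y Xx Xy|||].
- have -> : kernel (x * y^-1) <-> f (x * y^-1) = 0%R.
    by split=> [[]//|]; split=> //; apply: XM (XV Xy).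
  rewrite fM ?(addhomV XG fM) //; last exact: XV.
  split=> [->|/eqP]; first by rewrite GRing.subrr.
  by rewrite GRing.subr_eq0 => /eqP.
- by rewrite (addhom1 XG fM) transv0.
- by move=> x s Xx Ss [i e iv]; rewrite f_transvs // e fa transv_add.
move=> x Xx; set v := f x; case E: (code v) => [|l ls]; [left|right].
  by rewrite /transv E wval_nil.
have ls_sorted : path le_letter l ls by have := code_sorted leI_total v; rewrite E.
have ls_coh : coherent ls.
  move=> k k' kls k'ls; have := @code_coherent _ leI v; rewrite E.
  by apply; rewrite inE ?kls ?k'ls orbT.
pose v' : {freeg I} := svec ls.
have ev : v = (v' + lvec l)%R by rewrite -(svec_code leI v) E svec_cons GRing.addrC.
have cv' : code v' = ls.
  by apply: code_uniq => //; exact: path_sorted ls_sorted.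
have lv' : above l.1 v'.
  move=> k /(mem_code_dom leI); rewrite cv' => kls.
  have le_trans : transitive le_letter by move=> ? ? ?; apply: leI_trans.
  have := order_path_min le_trans ls_sorted.
  by move/allP => /(_ _ kls).
have lv : above l.1 v by rewrite ev; apply: aboveD.
exists (transv v'), (a l.1); rewrite f_transv; split=> //.
- exact: transvX.
- by rewrite cv'.
move: ev lv lv'; case: (l) => i [] /= ev lv lv'; [left|right].
  by split; [exists i|rewrite -transv_add // ev].
split; first by exists i.
rewrite -transv_add // ev -GRing.addrA /lvec /= freegUD GRing.addNr.
by rewrite freegU0 GRing.addr0.
Qed.

Lemma transv_free : free_family transv_edges transv_gen.
Proof.
have [h1 h2 h3 h4 h5] := transv_hyps.
exact: (schreier_free (ht := fun v => size (code v)) XG SB kernelG h1 h2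
  (fun x _ => transvX _) (fun x _ => f_transv _) h3 h4 h5).
Qed.

Lemma transv_span : span transv_edges transv_gen = kernel.
Proof.
have [h1 h2 h3 h4 h5] := transv_hyps.
exact: (schreier_span XG SB kernelG h1 h2 (fun x _ => transvX _)
  (fun x _ => f_transv _) h3 h4).
Qed.

(** The sign beta of the first entry b of the commutator attached to a Schreier generator
(v, b). It is +1 for b in B, as the condition is then void. If b = a_i, the last factor
in the expansion of the commutator is the generator at v, or the inverse of the one at v,
with v equal to minus the sum of the list, minus i when beta is +1; by coherence the
coefficient of v at i is negative exactly when beta is +1. *)
Definition edge_sign (e : {freeg I} * G) : bool :=
  `[< forall i, e.2 = a i -> (coeff i e.1 < 0)%R >].

Definition edge_code (e : {freeg I} * G) : seq (I * bool) :=
  code (- (if edge_sign e then e.1 + f e.2 else e.1))%R.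

(** The Schreier generator which appears last in the expansion of [s^b, ls]. *)
Definition coded_edge s b ls : {freeg I} * G :=
  ((if b then - svec ls - f s else - svec ls)%R, s).

Definition U_elt (e : {freeg I} * G) : G :=
  left_normed_comm (letter_val (e.2, edge_sign e)) (map (lval a) (edge_code e)).

Definition coherent_with s b ls :=
  forall l, l \in ls -> s = a l.1 -> l.2 = b.

Lemma edge_codeK e : coded_edge e.2 (edge_sign e) (edge_code e) = e.
Proof.
case: e => v s; rewrite /coded_edge /edge_code /=; congr pair.
case: (edge_sign _); rewrite svec_code GRing.opprK //.
by rewrite GRing.addrK.
Qed.

(** Together with [code_coherent], this is index coherence of the commutator. *)
Lemma edge_code_coherent e : coherent_with e.2 (edge_sign e) (edge_code e).
Proof.
case: e => v s l /(mem_code (leI := leI)) [] /=; rewrite mem_dom /edge_sign /=.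
case: asboolP => [neg|nneg] /= c0 -> es.
  have := neg _ es; rewrite es fa coeffN coeffD coeffU eqxx.
  by move: (coeff _ _) => c; lia.
have {nneg} : ~ (coeff l.1 v < 0)%R.
  by move=> cn; apply: nneg => i; rewrite es => /a_inj <-.
by move: c0; rewrite coeffN; move: (coeff _ _) => c; lia.
Qed.

Lemma edge_sign_notA e : (forall i, e.2 <> a i) -> edge_sign e = true.
Proof. by move=> nA; apply/asboolP => i /nA. Qed.

(** The converse of [edge_codeK]: coherence makes sign and list recoverable from the
vector. *)
Lemma coded_edgeK s b ls : S s -> sorted le_letter ls -> coherent ls ->
  coherent_with s b ls -> ((forall i, s <> a i) -> b = true) ->
  edge_sign (coded_edge s b ls) = b /\ edge_code (coded_edge s b ls) = ls.
Proof.
move=> Ss ls_sorted ls_coh sb nA.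
have eb : edge_sign (coded_edge s b ls) = b.
  have [[i ei]|no] := pselect (exists i, s = a i); last first.
    have nA' i : s <> a i by move=> ei; apply: no; exists i.
    by rewrite (nA nA') edge_sign_notA.
  have cnt : count_mem (i, ~~ b) ls = 0%N.
    apply/eqP; rewrite -leqn0 leqNgt -has_count has_pred1; apply/negP => il.
    by have := sb _ il ei; case: (b).
  have c_i := coeff_svec i ls.
  have -> : edge_sign (coded_edge s b ls) = (coeff i (coded_edge s b ls).1 < 0)%R.
    rewrite /edge_sign; apply/asboolP/idP => /= [h|lt0 k]; first exact: h ei.
    by rewrite {1}ei => /a_inj <-.
  rewrite /coded_edge /= ei fa; case: (b) cnt => /= cnt.
    by rewrite coeffD !coeffN coeffU eqxx c_i cnt; lia.
  by rewrite coeffN c_i cnt; lia.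
split=> //; rewrite /edge_code eb /coded_edge /=.
have -> : (- (if b then (if b then - svec ls - f s else - svec ls) + f s
    else if b then - svec ls - f s else - svec ls) = svec ls)%R.
  by case: (b); rewrite ?GRing.subrK GRing.opprK.
exact: code_uniq.
Qed.

(** The factor contributed by the letter s^b read at v: a Schreier generator or the
inverse of one. *)
Let gen_at v s b := transv v * letter_val (s, b) *
  (transv (if b then v + f s else v - f s)%R)^-1.

(** The position of the factor contributed by the sublist [ls]. *)
Let shift s b ls : {freeg I} := (if b then - svec ls - f s else - svec ls + f s)%R.

Lemma transv_subl l v : above l.1 v ->
  transv (v - lvec l)%R = transv v * (lval a l)^-1.
Proof. by move=> lv; rewrite -lvec_flip transv_addl // lval_flip. Qed.

(** By the hypothesis on v, t_v and t_(v-l) differ by the letter l only. *)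
Lemma conj_comm v x l : above l.1 v ->
  transv v * [~ x, lval a l] * (transv v)^-1 =
  (transv v * x * (transv v)^-1)^-1 *
  (transv (v - lvec l)%R * x * (transv (v - lvec l)%R)^-1).
Proof.
move=> lv; rewrite transv_subl // /commg /conjg !invgM !invgK !mulgA.
by rewrite mulgVK.
Qed.

(** Induction on the list by [conj_comm]: the expansion for a list ending in l is the
inverse of the expansion of the shorter list at v, followed by its expansion at v - l.
Sortedness keeps the remaining letters at most every index in the support of v - l. *)
Lemma comm_expand s b ls v : S s -> ls != [::] -> sorted le_letter ls ->
  (forall l, l \in ls -> above l.1 v) ->
  (forall i, s = a i -> leI (head (i, true) ls).1 i) ->
  exists2 W, span [set ls' | subseq ls' ls /\ (size ls' < size ls)%N]
      (fun ls' => gen_at (v + shift s b ls')%R s b) W &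
    transv v * left_normed_comm (letter_val (s, b)) (map (lval a) ls) *
      (transv v)^-1 = W * gen_at (v + shift s b ls)%R s b.
Proof.
move=> Ss; elim/last_ind: ls v => // ls l IH v _ ls_sorted lsv hd.
have lv : above l.1 v by apply: lsv; rewrite mem_rcons mem_head.
rewrite map_rcons /left_normed_comm foldl_rcons -/(left_normed_comm _ _).
have [els|nls] := eqVneq ls [::].
  subst ls; rewrite /= in hd *.
  pose d : {freeg I} := if b then (- f s)%R else f s.
  have vd : above l.1 (v + d)%R.
    have [[i ei]|no] := pselect (exists i, s = a i); last first.
      rewrite /d fB //; last by move=> i ei; apply: no; exists i.
      by rewrite GRing.oppr0 if_same GRing.addr0.
    have -> : d = lvec (i, ~~ b).
      by rewrite /d ei fa /lvec /=; case: (b); rewrite ?freegUN.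
    by apply: aboveD => //=; apply: hd.
  (* The commutator [s^b, l] has two factors, at v + d and at v + d - l. *)
  have e0 : shift s b [::] = d.
    by rewrite /shift /d /svec big_nil GRing.oppr0; case: (b); rewrite GRing.add0r.
  have e1 : (v + shift s b [:: l] = v + d - lvec l)%R.
    rewrite /shift /d /svec big_seq1; case: (b).
      by rewrite -[in RHS]GRing.addrA [(- f s - _)%R]GRing.addrC.
    by rewrite -[in RHS]GRing.addrA [(f s - _)%R]GRing.addrC.
  exists (gen_at (v + d)%R s b)^-1.
    rewrite -e0; apply: spanV.
    exact: (@span_gen _ _ [set ls' | _]
      (fun ls' => gen_at (v + shift s b ls')%R s b) [::]).
  have ed w : (if b then w + d + f s else w + d - f s)%R = w.
    by rewrite /d; case: (b); rewrite ?GRing.subrK ?GRing.addrK.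
  rewrite e1 /gen_at ed [(v + d - lvec l)%R]GRing.addrAC ed GRing.addrAC.
  rewrite !transv_subl // /commg /conjg !invgM !invgK !mulgA.
  by rewrite mulgVK.
have hd' : forall i, s = a i -> leI (head (i, true) ls).1 i.
  by move=> i ei; have := hd i ei; case: (ls) nls.
have ls_sorted' : sorted le_letter ls.
  by move: ls_sorted; rewrite -cats1 => /cat_sorted2[].
have le_l k : k \in ls -> leI k.1 l.1.
  move=> kls; have le_trans : transitive le_letter by move=> ? ? ?; apply: leI_trans.
  move: ls_sorted; rewrite -rev_sorted rev_rcons /= => /order_path_min.
  have tr : transitive (fun y x => le_letter x y).
    by move=> ? ? ? h1 h2; apply: leI_trans h2 h1.
  by move/(_ tr)/allP/(_ k); rewrite mem_rev; apply.
have [|W1 W1s e1] := IH v nls ls_sorted' _ hd'.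
  by move=> k kls; apply: lsv; rewrite mem_rcons inE kls orbT.
have [|W2 W2s e2] := IH (v - lvec l)%R nls ls_sorted' _ hd'.
  move=> k kls; apply: aboveB; first exact: le_l.
  by apply: lsv; rewrite mem_rcons inE kls orbT.
have esh ls' : (v - lvec l + shift s b ls' = v + shift s b (rcons ls' l))%R.
  rewrite -GRing.addrA; congr (_ + _)%R; rewrite /shift svec_rcons GRing.opprD.
  by case: (b); rewrite -GRing.addrA GRing.addrCA.
exists ((W1 * gen_at (v + shift s b ls)%R s b)^-1 * W2); last first.
  by rewrite conj_comm // e1 e2 esh mulgA.
have sub1 : subseq ls (rcons ls l) by apply: subseq_rcons.
apply: spanM; first apply: spanV; first apply: spanM.
- apply: spanS W1s => ls' [sub lt_ls]; split; first exact: subseq_trans sub1.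
  by rewrite size_rcons ltnS ltnW.
- apply: (@span_gen _ _ [set ls' | _] (fun ls' => gen_at (v + shift s b ls')%R s b)).
  by split=> //; rewrite size_rcons.
apply: span_sub W2s => ls' [sub lt_ls]; rewrite esh.
apply: (@span_gen _ _ [set ls' | _] (fun ls' => gen_at (v + shift s b ls')%R s b)).
split; last by rewrite !size_rcons.
by rewrite -!cats1; apply: cat_subseq.
Qed.

Let gen_at_coded s b ls : S s -> gen_at (shift s b ls) s b =
  (if b then transv_gen (coded_edge s b ls) else (transv_gen (coded_edge s b ls))^-1).
Proof.
move=> Ss; rewrite /gen_at /shift /coded_edge; case: b => /=.
  by rewrite transv_genE.
by rewrite transv_genE // !invgM invgK GRing.addrK mulgA.
Qed.

Let edge_lt (e e' : {freeg I} * G) : Prop := (size (edge_code e) < size (edge_code e'))%N.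

Let edge_lt_wf : well_founded edge_lt.
Proof.
exact: (wf_inverse_image _ _ _ (fun e => size (edge_code e)) ltn_well_founded).
Qed.

(** Outside the tree some index of v lies strictly below i, and it occurs in the list;
this yields the condition b > a_1. *)
Lemma edge_head v i d : ~ tree_edge v (a i) ->
  [/\ edge_code (v, a i) != [::], leI (head d (edge_code (v, a i))).1 i &
      (head d (edge_code (v, a i))).1 != i].
Proof.
move=> nt; have [k kv nik] : exists2 k, k \in dom v & ~~ leI i k.
  apply: contrapT => no; apply: nt; exists i => // k kv; apply: contrapT => /negP nik.
  by apply: no; exists k.
have ki : i != k by apply: contraNneq nik => ->; apply: leI_refl.
have [k' k'c ek] : exists2 l, l \in edge_code (v, a i) & l.1 = k.
  have : k \in dom (- (if edge_sign (v, a i) then v + f (a i) else v))%R.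
    rewrite domN; case: ifP => _ //; rewrite mem_dom.
    by rewrite coeffD fa coeffU (negbTE ki) GRing.mulr0 GRing.addr0 -mem_dom.
  by move/(mem_code_dom leI) => kc; eexists; first exact: kc.
have : sorted le_letter (edge_code (v, a i)) by apply: code_sorted.
case: (edge_code _) k'c => //= h ls k'c h_sorted.
have hk : leI h.1 k.
  move: k'c; rewrite inE => /orP[/eqP <-|k'ls]; first by rewrite -ek leI_refl.
  have le_trans : transitive le_letter by move=> ? ? ?; apply: leI_trans.
  by rewrite -ek; apply: (allP (order_path_min le_trans h_sorted) _ k'ls).
have ki' : leI k i by have := leI_total i k; rewrite (negbTE nik).
split=> //; first exact: leI_trans ki'.
by apply: contraNneq nik => <-.
Qed.

(** The factors of W in [comm_expand] are attached to proper sublists; each of them is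
either a Schreier generator with a shorter list or trivial, being a tree edge. *)
Lemma U_basis_change : basis_change transv_edges transv_gen U_elt.
Proof.
have Wex e : exists W, transv_edges e ->
    span [set e' | transv_edges e' /\ edge_lt e' e] transv_gen W /\
    U_elt e = W * (if edge_sign e then transv_gen e else (transv_gen e)^-1).
  have [ee|ne] := pselect (transv_edges e); last by exists 1.
  case: e ee => v s ee; have /transv_edgesP[Ss nt] := ee.
  pose b := edge_sign (v, s); pose ls := edge_code (v, s).
  have ec : coded_edge s b ls = (v, s) by apply: (edge_codeK (v, s)).
  have nA_b : (forall i, s <> a i) -> b = true by move=> nA; apply: edge_sign_notA.
  have [ls0|ls_n0] := eqVneq ls [::].
    have nA i : s <> a i.
      move=> ei; rewrite ei in nt; have [] := edge_head (i, true) nt.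
      by rewrite -ei -/ls ls0.
    exists 1 => _; split; first exact: span1.
    rewrite mul1g /U_elt -/b -/ls ls0 nA_b //= -ec transv_genE //.
    rewrite ls0 nA_b // /svec big_nil fB // GRing.oppr0 !GRing.addr0 transv0.
    by rewrite invg1 mulg1 mul1g.
  have ls_sorted : sorted le_letter ls by apply: code_sorted.
  have ls_coh : coherent ls by apply: code_coherent.
  have [||W Ws eW] := comm_expand b (v := 0%R) Ss ls_n0 ls_sorted.
  - by move=> l _; apply: above0.
  - move=> i ei; move: (nt); rewrite ei => /(edge_head (i, true))[_].
    by rewrite -ei.
  exists W => _; split; last first.
    move: eW; rewrite transv0 mul1g invg1 mulg1 GRing.add0r gen_at_coded // ec.
    exact.
  apply: (span_min (@span_subgroup _ _ _ _) _ Ws) => ls' [sub lt_ls'].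
  rewrite GRing.add0r gen_at_coded //.
  have [e1 e2] : edge_sign (coded_edge s b ls') = b /\
      edge_code (coded_edge s b ls') = ls'.
    apply: coded_edgeK => //.
    - apply: (subseq_sorted _ sub ls_sorted) => ? ? ?; exact: leI_trans.
    - by move=> l l' /(mem_subseq sub) lls /(mem_subseq sub) l'ls; apply: ls_coh.
    by move=> l /(mem_subseq sub) lls; apply: (@edge_code_coherent (v, s)).
  suff : span [set e' | transv_edges e' /\ edge_lt e' (v, s)] transv_gen
      (transv_gen (coded_edge s b ls')).
    by case: (b) => // /spanV.
  have [tr|ntr] := pselect (tree_edge (coded_edge s b ls').1 s).
    by rewrite transv_gen_tree //; apply: span1.
  apply: span_gen; split; first exact/transv_edgesP.
  by rewrite /edge_lt e2.
have [W WP] := choice Wex.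
apply: (basis_change_triangular (W := W) (e := edge_sign) edge_lt_wf).
  by move=> e /WP[].
by move=> e /WP[].
Qed.

Lemma U_free_basis : free_basis (U_elt @` transv_edges) kernel.
Proof.
have [e _] := U_basis_change; rewrite -transv_span -e.
apply: free_family_basis; exact: basis_change_free U_basis_change transv_free.
Qed.

Variable le : rel G.
Let A : set G := range a.
Let B : set G := S `\` A.
Hypothesis le_A : forall i j, le (a i) (a j) = leI i j.
Hypothesis le_AB : forall i s, B s -> le (a i) s.

Let letter (l : I * bool) : G * bool := (a l.1, l.2).

(** Edges with an empty list give B, the others give U. Conversely [coded_edgeK] finds the
edge of a given commutator, and a_1 < b keeps it out of the tree. *)
Lemma U_elt_image : U_elt @` transv_edges = B `|` U_construction A B le.
Proof.
have letter_a ls : [seq letter_val k | k <- map letter ls] = map (lval a) ls.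
  by rewrite -map_comp.
have memL x ls k : k \in x :: map letter ls ->
    k = x \/ exists2 l, l \in ls & k = letter l.
  by rewrite in_cons => /orP[/eqP|/mapP]; [left|right].
have memR x ls l : l \in ls -> letter l \in x :: map letter ls.
  by move=> lls; rewrite in_cons (map_f letter lls) orbT.
apply/seteqP; split=>
  [_ [[v s] ee <-]|u [Bu|[[s b] [a1 [s0 [Sb As lea srt [Bb coh ->]]]]]]].
- have /transv_edgesP[Ss nt] := ee.
  have [[i ei]|no] := pselect (exists i, s = a i); last first.
    have nA i : s <> a i by move=> ei; apply: no; exists i.
    have Bs : B s by split=> // -[i _ e]; apply: (nA i).
    have b1 := @edge_sign_notA (v, s) nA.
    rewrite /U_elt b1 /=; case E: (edge_code (v, s)) => [|h ls]; first by left.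
    right; exists (s, true), (letter h), (map letter ls); split.
    + by right.
    + by move=> l; rewrite -map_cons => /mapP[k _ ->]; exists k.1.
    + by rewrite le_AB //=; apply/eqP => e; apply: (nA h.1).
    + rewrite -map_cons -map_comp sorted_map.
      have := code_sorted leI_total (- (if edge_sign (v, s) then v + f s else v))%R.
      rewrite -/(edge_code (v, s)) E; apply: sub_sorted => l l' /=.
      by rewrite le_A.
    split=> //; last by rewrite -map_cons letter_a.
    have := @edge_code_coherent (v, s).
    have := @code_coherent _ leI (- (if edge_sign (v, s) then v + f s else v))%R.
    rewrite -/(edge_code (v, s)) E b1 => coh _ l l'.
    rewrite -map_cons => /memL[->|[k kls ->]] /memL[->|[k' kls' ->]] //=.
    + by move=> e; case: (nA k'.1).
    + by move=> e; case: (nA k.1).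
    by move/a_inj; apply: coh.
  subst s; right; have [n0 le_h ne_h] := edge_head (i, true) nt.
  have sE := @edge_code_coherent (v, a i).
  have coh := @code_coherent _ leI (- (if edge_sign (v, a i) then v + f (a i) else v))%R.
  have srt := code_sorted leI_total (- (if edge_sign (v, a i) then v + f (a i) else v))%R.
  rewrite -/(edge_code (v, a i)) in coh srt.
  rewrite /U_elt /=; move: n0 le_h ne_h sE coh srt.
  case: (edge_code (v, a i)) => // h ls _ /= le_h ne_h sE coh srt.
  exists (a i, edge_sign (v, a i)), (letter h), (map letter ls); split.
  + by left; exists i.
  + by move=> l; rewrite -map_cons => /mapP[k _ ->]; exists k.1.
  + by rewrite /= le_A le_h (inj_eq a_inj).
  + rewrite -map_cons -map_comp sorted_map.
    have srt' : sorted le_letter (h :: ls) by [].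
    by apply: sub_sorted srt' => l l' /=; rewrite le_A.
  split=> //; last by rewrite -map_cons letter_a.
  + by case=> _ []; exists i.
  move=> l l'.
  rewrite -map_cons => /memL[->|[k kls ->]] /memL[->|[k' kls' ->]] //= e.
  + by rewrite (sE k').
  + by rewrite (sE k).
  by apply: coh => //; apply: a_inj.
- have [Su nAu] := Bu.
  have nA i : u <> a i by move=> e; apply: nAu; exists i.
  exists (0%R, u).
    by apply/transv_edgesP; split=> // -[i /nA].
  rewrite /U_elt /edge_code edge_sign_notA // fB // GRing.addr0 GRing.oppr0 code0.
  by [].
have [ls els] : exists ls, a1 :: s0 = map letter ls.
  elim: (a1 :: s0) As {lea srt coh Bb} => [|l ls IH] As; first by exists [::].
  have [i _ ei] := As l (mem_head _ _).
  have [|ls' ->] := IH; first by move=> k kls; apply: As; rewrite inE kls orbT.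
  by exists ((i, l.2) :: ls'); rewrite /= /letter /= ei; case: (l).
case: ls els => // h ls els.
rewrite /= in Sb lea Bb; rewrite els letter_a.
have Ss : S s by case: Sb => [[i _ <-]|[]].
have ls_sorted : sorted le_letter (h :: ls).
  move: srt; rewrite els -map_comp sorted_map; apply: sub_sorted => l l' /=.
  by rewrite le_A.
rewrite els in coh.
have ls_coh : coherent (h :: ls).
  move=> l l' lls l'ls e; apply: (coh (letter l) (letter l')).
  - exact: memR.
  - exact: memR.
  by rewrite /= e.
have sb : coherent_with s b (h :: ls).
  move=> l lls e; apply: (coh (letter l) (s, b)) => //; last by rewrite inE eqxx.
  exact: memR.
have nA_b : (forall i, s <> a i) -> b = true.
  by move=> nA; apply: Bb; split=> // -[i _ e]; apply: (nA i).
have [e1 e2] := coded_edgeK Ss ls_sorted ls_coh sb nA_b.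
exists (coded_edge s b (h :: ls)); last by rewrite /U_elt e1 e2.
apply/transv_edgesP; split=> // -[i ei].
have [ea1 _] : a1 = letter h /\ s0 = map letter ls by case: els.
have hi : h.1 != i by have /andP[_] := lea; rewrite ea1 ei (inj_eq a_inj).
have le_hi : leI h.1 i by have /andP[] := lea; rewrite ea1 ei le_A.
move=> /(_ h.1); rewrite mem_dom ei fa.
have hdom := dom_svec ls_coh (mem_head _ _).
suff -> : coeff h.1 (if b then - svec (h :: ls) - << i >> else - svec (h :: ls))%R
    = (- coeff h.1 (svec (h :: ls)))%R.
  rewrite GRing.oppr_eq0 -mem_dom => /(_ hdom) le_ih.
  by move/eqP: hi; apply; apply: leI_anti; rewrite le_hi.
case: (b); rewrite ?coeffB coeffN ?coeffU // eq_sym (negbTE hi).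
by rewrite GRing.mulr0 GRing.subr0.
Qed.

End UBasis.

(** * The theorem *)

Section Assembly.
Local Open Scope group_scope.
Local Open Scope classical_set_scope.
Variable F : groupType.
Implicit Types (X Y : set F).

Lemma coset_mulE X Y x y : normal_subgroup Y X -> X y ->
  set_prod (left_coset x Y) (left_coset y Y) = left_coset (x * y) Y.
Proof.
move=> [YG YX Ynorm] Xy; apply/seteqP.
split=> [_ [_ [u Yu <-] [_ [v Yv <-] <-]]|_ [v Yv <-]].
  exists (u ^ y * v); first by apply: subgroupM => //; apply: Ynorm.
  by rewrite /conjg !mulgA mulgK.
exists (x * 1); first by exists 1 => //; apply: subgroup1.
by exists (y * v); [exists v|rewrite mulg1 mulgA].
Qed.

Lemma coset_eqP Y x y : subgroup Y ->
  left_coset x Y = left_coset y Y <-> Y (y^-1 * x).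
Proof.
move=> YG; split=> [e|Yxy].
  have : left_coset x Y x by exists 1; rewrite ?mulg1 //; apply: subgroup1.
  by rewrite e => -[u Yu <-]; rewrite mulKg.
apply/seteqP; split=> _ [u Yu <-].
  exists (y^-1 * x * u); first exact: subgroupM.
  by rewrite !mulgA mulgV mul1g.
exists ((y^-1 * x)^-1 * u); first by apply: subgroupM => //; apply: subgroupV.
by rewrite invgM invgK !mulgA mulgV mul1g.
Qed.

(** Composing the given isomorphism with x |-> xY; normality makes this additive. *)
Lemma quotient_hom X Y : subgroup X -> normal_subgroup Y X ->
  free_abelian_quotient X Y ->
  exists (I : choiceType) (f : F -> {freeg I}), [/\ addhom X f,
    forall v, exists2 x, X x & f x = v & kernel X f = Y].
Proof.
move=> XG Yn [I [phi [[_ phi_inj phi_surj] phiM]]]; have [YG YX _] := Yn.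
pose f x := phi (left_coset x Y).
have fM : addhom X f.
  move=> x y Xx Xy; rewrite /f -(coset_mulE _ Yn Xy) phiM //; rewrite inE.
    by exists x.
  by exists y.
exists I, f; split=> //.
  by move=> v; have [|_ [x Xx <-] <-] := phi_surj v; [|exists x].
have f1 : f 1 = 0%R by apply: addhom1 fM.
apply/seteqP; split=> [x [Xx]|x Yx].
  rewrite -f1 => /phi_inj; rewrite !inE => e.
  have /coset_eqP : left_coset x Y = left_coset 1 Y.
    by apply: e; [exists x|exists 1 => //; apply: subgroup1].
  by rewrite invg1 mul1g; apply.
split; first exact: YX.
by rewrite -f1 /f; congr phi; apply/coset_eqP; rewrite // invg1 mul1g.
Qed.

Lemma exists_adapted_basis X (I : choiceType) (S : set F) (f : F -> {freeg I}) :
  subgroup X -> free_basis S X -> addhom X f ->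
  (forall v, exists2 x, X x & f x = v) ->
  exists (S' : set F) (a : I -> F), [/\ free_basis S' X, forall i, S' (a i),
    injective a, forall i, f (a i) = << i >> &
    forall s, S' s -> (forall i, s <> a i) -> f s = 0%R].
Proof.
move=> XG SB fM fonto; have SX := span_basis XG SB.
have fM' : addhom (span S id) f by rewrite SX.
have fonto' v : exists2 x, span S id x & f x = v by rewrite SX.
have [z [s [bc s_inj Ss fs f0]]] := adapted_basis fM' 1 fonto'.
have zfree := basis_change_free bc (free_basis_family XG SB).
exists (z @` S), (z \o s); split=> //.
- by have := free_family_basis zfree; rewrite bc.1 SX.
- by move=> i; exists (s i).
- by move=> i j /(free_family_inj zfree (Ss i) (Ss j)) /s_inj.
move=> _ [j Sj <-] ne; apply: f0 => // i; apply/eqP => e.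
by apply: (ne i); rewrite /= e.
Qed.

End Assembly.

Local Open Scope classical_set_scope.

Theorem theorem2p1 (F : groupType) (X Y : set F)
    (hF : free_group F)
    (hX : subgroup X)
    (hY : normal_subgroup Y X)
    (hXY : free_abelian_quotient X Y) :
  exists (A B : set F) (le : rel F),
    [/\ A `&` B = set0,
        free_basis (A `|` B) X,
        total_order_on (A `|` B) le,
        (forall a b : F, A a -> B b -> le a b) &
        free_basis (B `|` U_construction A B le) Y].
Proof.
have [S0 S0B] := hF; have [S1 S1B] := subgroup_free_basis S0B hX.
have [I [f [fM fonto kerf]]] := quotient_hom hX hY hXY.
have [S [a [SB aS a_inj fa fB]]] := exists_adapted_basis hX S1B fM fonto.
have [le0 [leR leA leT leTot _]] := exists_well_order F.
pose A : set F := range a; pose B := S `\` A.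
have AB : A `|` B = S.
  apply/seteqP; split=> x; first by case=> [[i _ <-]|[]].
  by have [Ax|nAx] := pselect (A x); [left|right].
pose le x y := if x \in A then (y \notin A) || le0 x y else (y \notin A) && le0 x y.
have aA i : a i \in A by rewrite inE; exists i.
pose leI i j := le0 (a i) (a j).
have leI_anti : antisymmetric leI by move=> i j /leA /a_inj.
exists A, B, le; split.
- by apply/seteqP; split=> // x [Ax []].
- by rewrite AB.
- split.
  + by move=> x _; rewrite /le leR; case: (x \in A).
  + move=> x y _ _; rewrite /le => xy; apply: leA; move: xy.
    by case: (x \in A); case: (y \in A); rewrite //= ?andbF.
  + move=> y x z _ _ _; rewrite /le.
    by case: (x \in A); case: (y \in A); case: (z \in A) => //=; apply: leT.
  move=> x y _ _; rewrite /le; have := leTot x y.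
  by case: (x \in A); case: (y \in A); rewrite //= ?orbT.
- by move=> x y Ax [_ nAy]; rewrite /le (mem_set Ax) (memNset nAy).
have le_A i j : le (a i) (a j) = leI i j by rewrite /le !aA.
have le_AB i s : B s -> le (a i) s by move=> [_ nAs]; rewrite /le aA (memNset nAs).
have leIR : reflexive leI by move=> i; apply: leR.
have leIT : transitive leI by move=> j i k; apply: leT.
have leItot : total leI by move=> i j; apply: leTot.
rewrite -(U_elt_image hX SB fM aS a_inj fa fB leIR leI_anti leIT leItot le_A le_AB).
by rewrite -kerf; apply: U_free_basis.
Qed.
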